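(* Let $p\ge1$, let $(X,d,\mathfrak m)$ be a doubling metric measure space such that $(X,d)$ is complete, and let $x,y\in X$. The following properties are equivalent: (i) there exist $C>0$ and $L\ge1$ such that for every $u\in\mathrm{Lip}(X)$ $$|u(x)-u(y)|^p\le C\,d(x,y)^{p-1}\int(\mathrm{lip}\,u)^p\,d\mathfrak m^L_{x,y};$$ (ii) there exist $C>0$ and $L\ge1$ such that for every Borel function $g:X\to[0,+\infty]$ with $g(x),g(y)<+\infty$ it holds $$\lim_{\varepsilon\to0}\ \inf_{\substack{c\in\mathscr C^\varepsilon_{x,y}\\ \ell(c)\le C d(x,y)}}\Big(\int_c g\Big)^p\le C\,d(x,y)^{p-1}\int g^p\,d\mathfrak m^L_{x,y};$$ (iii) there exist $C>0$ and $L\ge1$ such that $$|u(x)-u(y)|^p\le C\,d(x,y)^{p-1}\int g^p\,d\mathfrak m^L_{x,y}$$ for every Borel $u:X\to\mathbb R$, for every $\varepsilon>0$ and for every $g\in\mathrm{UG}^\varepsilon(u)$ such that $g(x),g(y)<+\infty$; (iii)$_{\mathrm{UG}}$ there exist $C>0$ and $L\ge1$ such that for every Borel $u:X\to\mathbb R$ and for every $g\in\mathrm{UG}(u)$ it holds $$|u(x)-u(y)|^p\le C\,d(x,y)^{p-1}\int g^p\,d\mathfrak m^L_{x,y}.$$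
   Context: A metric measure space $(X,d,\mathfrak m)$ is a separable metric space $(X,d)$ with a non-trivial outer measure $\mathfrak m$ which is Radon and finite on bounded sets. It is doubling if there is $C_D\ge1$ with $\mathfrak m(B_{2r}(x))\le C_D\,\mathfrak m(B_r(x))$ for all $x\in X$, $r>0$. $\mathrm{Lip}(X)$ is the set of Lipschitz functions $X\to\mathbb R$ and $\mathrm{lip}\,u(z):=\lim_{\varepsilon\to0}\sup_{w\in B_\varepsilon(z),\,w\ne z}\frac{|u(w)-u(z)|}{d(z,w)}$ (equal to $0$ at isolated points). For $\varepsilon>0$, an $\varepsilon$-chain is a finite sequence of points $c=\{q_i\}_{i=0}^N$ of $X$ with $d(q_i,q_{i+1})\le\varepsilon$ for all $i$; $\alpha(c)=q_0$, $\omega(c)=q_N$, and its length is $\ell(c)=\sum_{i=0}^{N-1}d(q_i,q_{i+1})$. $\mathscr C^\varepsilon_{x,y}$ is the set of $\varepsilon$-chains $c$ with $\alpha(c)=x$, $\omega(c)=y$. For $g:X\to[0,+\infty]$, $\int_c g:=\sum_{i=0}^{N-1}\frac{g(q_i)+g(q_{i+1})}{2}d(q_i,q_{i+1})$ (with $0\cdot\infty=0$). A Borel function $g:X\to[0,+\infty]$ belongs to $\mathrm{UG}^\varepsilon(u)$ if $|u(\omega(c))-u(\alpha(c))|\le\int_c g$ for every $\varepsilon$-chain $c$. The infimum over the empty set is $+\infty$. A curve is a continuous map $\gamma:[a,b]\to X$, $\alpha(\gamma)=\gamma(a)$, $\omega(\gamma)=\gamma(b)$; it is rectifiable if its length $\ell(\gamma)$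 is finite. For Borel $g:X\to[0,+\infty]$, $\int_\gamma g:=\int_0^{\ell(\gamma)}g(\gamma'(t))\,dt$ where $\gamma'$ is the arc-length reparametrization of $\gamma$. A Borel function $g:X\to[0,+\infty]$ belongs to $\mathrm{UG}(u)$ (is an upper gradient of $u$) if $|u(\omega(\gamma))-u(\alpha(\gamma))|\le\int_\gamma g$ for every rectifiable curve $\gamma$. For $x,y\in X$, $L\ge1$, let $B^L_{x,y}=B_{Ld(x,y)}(x)\cup B_{Ld(x,y)}(y)$ and $$R^L_{x,y}(z):=\Big(\frac{d(x,z)}{\mathfrak m(B_{d(x,z)}(x))}+\frac{d(y,z)}{\mathfrak m(B_{d(y,z)}(y))}\Big)\chi_{B^L_{x,y}}(z),\qquad R^L_{x,y}(x)=R^L_{x,y}(y)=0,$$ and $\mathfrak m^L_{x,y}:=R^L_{x,y}\,\mathfrak m$. *)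

(* Defs.v *)
From HB Require Import structures.
From mathcomp Require Import all_boot all_order all_algebra.
From mathcomp Require Import all_classical all_reals all_analysis.
From mathcomp Require Import measurable_realfun.

Set Implicit Arguments.
Unset Strict Implicit.
Unset Printing Implicit Defensive.

Import Order.TTheory GRing.Theory Num.Theory.
Import numFieldTopology.Exports numFieldNormedType.Exports.

Local Open Scope classical_set_scope.
Local Open Scope ring_scope.

(* The base point contained in the completeness structure is only there because
   measurable types are pointed in the library; no definition below uses it. *)
#[short(type="completeMetricType")]
HB.structure Definition CompleteMetric (R : numDomainType) :=
  {T of Complete T & Metric R T}.

Section metric_measure_space.
Context {R : realType} {X : completeMetricType R}.
Implicit Types (m : {outer_measure set X -> \bar R}).
Local Open Scope ereal_scope.

Definition separable_space := exists2 S : set X, countable S & dense S.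

Definition metric_bounded (A : set X) :=
  exists M : R, forall a b, A a -> A b -> (mdist a b <= M)%R.

(* Radon in the sense of outer measures (Federer, 2.2.5). *)
Definition radon_outer m :=
  [/\ (<<s @open X >>) `<=` m.-caratheodory,
      forall K, compact K -> m K < +oo,
      forall V, open V ->
        m V = ereal_sup [set m K | K in [set K | compact K /\ K `<=` V]] &
      forall A,
        m A = ereal_inf [set m V | V in [set V | open V /\ A `<=` V]]].

Definition metric_measure_space m :=
  [/\ separable_space, m [set: X] != 0, radon_outer m &
      forall A, metric_bounded A -> m A < +oo].

Definition doubling m :=
  exists2 CD : R, (1 <= CD)%R &
    forall (z : X) (r : R), (0 < r)%R ->
      m (ball z (2 * r)%R) <= CD%:E * m (ball z r).

(* The Riesz-type kernel. Away from x and y the measures of the balls in the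
   denominators are positive and finite, by doubling. *)
Definition riesz_kernel m (L : R) (x y z : X) : \bar R :=
  if (z == x) || (z == y) then 0 else
  ((mdist x z)%:E / m (ball x (mdist x z)) +
   (mdist y z)%:E / m (ball y (mdist y z))) *
  (\1_(ball x (L * mdist x y)%R `|` ball y (L * mdist x y)%R) z)%:E.

(* The measure with density the kernel with respect to m, on the sigma-algebra
   of the Caratheodory-measurable sets of m, which contains the Borel sets. *)
Definition riesz_measure m (L : R) (x y : X)
    (A : set (caratheodory_type m)) : \bar R :=
  \int[(m : set (caratheodory_type m) -> \bar R)]_(z in A)
    riesz_kernel m L x y z.

Definition borel_real (u : X -> R) :=
  measurable_fun setT (u : g_sigma_algebraType (@open X) -> R).

Definition borel_nonneg (g : X -> \bar R) :=
  (forall z, 0 <= g z) /\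
  measurable_fun setT (g : g_sigma_algebraType (@open X) -> \bar R).

Definition Lipschitz (u : X -> R) :=
  exists K : R, forall a b, (`|u a - u b| <= K * mdist a b)%R.

Definition lip (u : X -> R) (z : X) : \bar R :=
  if `[< isolated [set: X] z >] then 0 else
  lim (ereal_sup [set (`|u w - u z| / mdist z w)%:E
                 | w in ball z e `\ z] @[e --> (0:R)^'+]).

(* The chain q_0, ..., q_N is given by its first point q = q_0 and the sequence
   s = q_1, ..., q_N, so that its end point is last q s. *)
Definition eps_chain (e : R) (q : X) (s : seq X) : bool :=
  path (fun a b => mdist a b <= e)%R q s.

Definition chains (e : R) (x y : X) : set (seq X) :=
  [set s | eps_chain e x s /\ last x s = y].

Definition chain_length (q : X) (s : seq X) : R :=
  (\sum_(l <- pairmap (fun a b => mdist a b) q s) l)%R.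

Definition chain_integral (g : X -> \bar R) (q : X) (s : seq X) : \bar R :=
  \sum_(l <- pairmap (fun a b => (g a + g b) / 2%:E * (mdist a b)%:E) q s) l.

Definition UG_eps (e : R) (u : X -> R) (g : X -> \bar R) :=
  borel_nonneg g /\
  forall q s, eps_chain e q s ->
    `|u (last q s) - u q|%:E <= chain_integral g q s.

Definition curve (gamma : R -> X) (a b : R) :=
  (a <= b)%R /\ {within `[a, b], continuous gamma}.

Definition curve_length (gamma : R -> X) (a b : R) : \bar R :=
  ereal_sup [set (\sum_(l <- pairmap (fun t t' => mdist (gamma t) (gamma t'))
                               a ts) l)%:E
            | ts in itv_partition a b].

Definition rectifiable (gamma : R -> X) (a b : R) :=
  curve_length gamma a b < +oo.

(* The arc-length reparametrization sends tau to gamma t, for any t in [a, b]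
   at which gamma has run a length tau; gamma t does not depend on the choice
   of t, since gamma is constant where the length run does not increase. *)
Definition arc_length_param (gamma : R -> X) (a b tau : R) : X :=
  gamma (xget a [set t | t \in `[a, b] /\ curve_length gamma a t = tau%:E]).

Definition curve_integral (g : X -> \bar R) (gamma : R -> X) (a b : R) :
    \bar R :=
  \int[lebesgue_measure]_(tau in `[0%R, fine (curve_length gamma a b)])
    g (arc_length_param gamma a b tau).

Definition UG (u : X -> R) (g : X -> \bar R) :=
  borel_nonneg g /\
  forall gamma a b, curve gamma a b -> rectifiable gamma a b ->
    `|u (gamma b) - u (gamma a)|%:E <= curve_integral g gamma a b.

End metric_measure_space.

Arguments separable_space {R} X.
Arguments riesz_measure {R X} m L x y A.

(* Main.v *)
Require Import Defs.
From HB Require Import structures.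
From mathcomp Require Import all_boot all_order all_algebra.
From mathcomp Require Import all_classical all_reals all_analysis.
From mathcomp Require Import measurable_realfun.
From mathcomp Require Import ring lra.
Set Implicit Arguments.
Unset Strict Implicit.
Unset Printing Implicit Defensive.

Import Order.TTheory GRing.Theory Num.Theory.
Import numFieldTopology.Exports numFieldNormedType.Exports.

Local Open Scope classical_set_scope.
Local Open Scope ring_scope.
Local Open Scope ereal_scope.

(** The properties are linked through a fifth one, joined_by_short_curves: if g ^ p has
    integral at most t for the Riesz measure, then x and y are joined by a curve of
    length at most B along which g has integral at most B t ^ (1 / p). As the constants
    are chosen after x and y, the powers of the distance of x and y are mere positive
    factors when x and y differ, and the Riesz measure enters only through its
    finiteness (riesz_measure_finite_measure), which follows from doubling.

    Curves from Lipschitz functions (short_curve_unit). Replace g by a lower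
    semicontinuous majorant h >= 1 (lsc_majorant) and write h as an increasing limit of
    Lipschitz functions g_k (cvg_lip_approx). The least cost, for the density g_k, of a
    chain with small steps from x to z is, after truncation, a Lipschitz function of z
    whose pointwise Lipschitz constant is at most g_k (lip_potential); the inequality
    for this function yields a cheap chain from x to y. Parametrized by their cost, these
    chains move with speed at most 1 / g_k <= 1. Closed balls being compact, they converge
    to a curve (limit_curve), whose speed is at most 1 / g_k for every k; hence the
    integral of each g_k along it, and then that of h, is bounded by the duration
    (curve_integral_le_duration).

    From curves one gets back to chains by sampling: a rectifiable curve carries chains
    with arbitrarily small steps over which the integral of g is at most twice that along
    the curve, up to a small error (curve_chain). Thus short curves give the second
    property, which gives the third one at once, since the integral of a gradient along
    chains is bounded below and the infimum is monotone in the size of the steps. Short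
    curves also give the fourth property by the definition of an upper gradient.

    To come back to Lipschitz functions u, use as gradient the supremum of the difference
    quotients of u at scale r (slope): it is a gradient along chains with steps smaller
    than r, and by sampling twice it is a gradient along curves (UG_of_UG_eps). As r tends
    to 0 it decreases to lip u, and dominated convergence applies. *)

(** * Difference quotients at a fixed scale *)

Section slopes.
Context {R : realType} {X : completeMetricType R}.
Implicit Types (u : X -> R) (z w : X).

(** The value 0 is adjoined so that the slope is 0, and not -oo, at a point with no
    other point at distance less than r. *)
Definition slope (r : R) u z : \bar R :=
  ereal_sup (0 |` [set (`|u w - u z| / mdist z w)%:E | w in ball z r `\ z]).

Lemma slope_ge0 r u z : 0 <= slope r u z.
Proof. by apply: ereal_sup_ubound; left. Qed.

Lemma slope_le_Lipschitz r u (K : R) z : (0 <= K)%R ->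
  (forall a b, (`|u a - u b| <= K * mdist a b)%R) -> slope r u z <= K%:E.
Proof.
move=> K0 uK; apply: ge_ereal_sup => _ [->|[w [_ /eqP wz] <-]].
  by rewrite lee_fin.
rewrite lee_fin ler_pdivrMr ?mdist_gt0 1?eq_sym//.
by rewrite metric_sym.
Qed.

Lemma le_slope_mdist r u z w : (mdist z w < r)%R ->
  `|u w - u z|%:E <= slope r u z * (mdist z w)%:E.
Proof.
move=> zw; have [<-|wz] := eqVneq z w.
  by rewrite subrr normr0 mdistxx mule0.
have d0 : (0 < mdist z w)%R by rewrite mdist_gt0.
rewrite -lee_pdivrMr// -EFinM; apply: ereal_sup_ubound; right.
by exists w => //; split; [rewrite ballEmdist|move=> /= /eqP; rewrite eq_sym (negbTE wz)].
Qed.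

Lemma mdist_continuous z : continuous (fun w => mdist z w).
Proof.
move=> w; apply/cvgrPdist_lt => e e0.
near=> t; have : (mdist w t < e)%R.
  near: t; apply/metricType_numDomainType.nbhs_mdistP; exists e => //.
apply: le_lt_trans; rewrite ler_norml.
have := metric_triangle z w t; have := metric_triangle z t w.
rewrite (metric_sym t w) => h1 h2; lra.
Unshelve. all: by end_near. Qed.

Lemma mdist_continuousl w : continuous (fun z => mdist z w).
Proof.
rewrite (_ : (fun z => mdist z w) = mdist w); first exact: mdist_continuous.
by apply/funext => z; rewrite metric_sym.
Qed.

Lemma open_mdist_gt z (s : R) : open [set w | (s < mdist z w)%R].
Proof.
have := @open_gt R s => /(open_comp (f := fun w => mdist z w)); apply.
by move=> w _; exact: mdist_continuous.
Qed.

(** A point w at which the difference quotient at z exceeds a does the same for all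
    points near z, since the ball is open. *)
Lemma open_slope_gt r u : continuous u ->
  forall a : \bar R, open [set z | a < slope r u z].
Proof.
move=> uc a; rewrite openE => z /= /ereal_sup_gt[_ [->|[w [zw /eqP wz] <-]] a0].
  by apply: filterE => t /=; exact: lt_le_trans (slope_ge0 _ _ _).
rewrite /interior.
have cd : mdist t w @[t --> z] --> mdist z w by exact: mdist_continuousl.
have d0 : (mdist z w != 0)%R by rewrite gt_eqF// mdist_gt0 eq_sym.
have cq : (`|u w - u t| / mdist t w)%:E @[t --> z] --> (`|u w - u z| / mdist z w)%:E.
  apply/cvg_EFin; first by near=> t.
  rewrite /comp/=; apply: cvgM; last exact: cvgV.
  by apply: cvg_norm; apply: cvgB; [exact: cvg_cst|exact: uc].
have aq : \forall t \near z, a < (`|u w - u t| / mdist t w)%:E.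
  exact: (cq _ (open_ereal_gt' a0)).
near=> t => /=; apply: (@lt_le_trans _ _ (`|u w - u t| / mdist t w)%:E).
  by near: t.
have zt : (0 < mdist t w)%R.
  by near: t; apply: (cvgr_gt _ cd); rewrite mdist_gt0 eq_sym.
apply: ereal_sup_ubound; right; exists w => //; split.
  rewrite ballEmdist/=; near: t; rewrite ballEmdist/= in zw.
  exact: (cvgr_lt _ cd).
by move=> /= wt; rewrite wt mdistxx ltxx in zt.
Unshelve. all: by end_near. Qed.

Lemma slope_nd r r' u z : (r <= r')%R -> slope r u z <= slope r' u z.
Proof.
move=> rr'; apply: ereal_sup_le => y [->|[w [zw wz] <-]]; first by left.
right; exists w => //; split => //.
by move: zw; rewrite !ballEmdist => /lt_le_trans; apply.
Qed.

(** The suprema in the definition of lip increase with the radius, so their limit is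
    an infimum; at an isolated point the slopes of small radius vanish. *)
Lemma lip_ereal_inf u z :
  lip u z = ereal_inf [set slope e u z | e in [set e : R | (0 < e)%R]].
Proof.
rewrite /lip; case: asboolP => [[_ [V zV VE]]|niso].
  apply/eqP; rewrite eq_le; apply/andP; split.
    by apply: le_ereal_inf_tmp => _ [e e0 <-]; exact: slope_ge0.
  apply: ge_ereal_inf; exists 0 => //.
  move: zV => /nbhs_ballP[e /= e0 zeV]; exists e => //.
  apply/eqP; rewrite eq_le slope_ge0 andbT; apply: ge_ereal_sup => y [->//|].
  move=> [w [zw wz] <-]; exfalso; apply: wz; rewrite /= .
  by have : [set z] w by rewrite -VE; split => //; exact: zeV.
set S := fun e : R => ereal_sup _.
have SE e : (0 < e)%R -> S e = slope e u z.
  move=> e0; apply/eqP; rewrite eq_le; apply/andP; split.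
    by apply: ereal_sup_le => y Sy; right.
  apply: ge_ereal_sup => y [->|Sy]; last exact: ereal_sup_ubound.
  have [w [zw wz]] : (ball z e `\ z) !=set0.
    apply: contrapT => /set0P/negP/negPn/eqP E0; apply: niso; split.
      by rewrite inE.
    exists (ball z e); first exact: nbhsx_ballx.
    rewrite setIT; apply/seteqP; split => [w zw|w ->]; last exact: ballxx.
    apply: contrapT => wz; suff : (ball z e `\ z) w by rewrite E0.
    by split.
  apply: (@le_trans _ _ (`|u w - u z| / mdist z w)%:E).
    by rewrite lee_fin divr_ge0// mdist_ge0.
  by apply: ereal_sup_ubound; exists w.
have -> : lim (S e @[e --> (0 : R)^'+]) = ereal_inf (S @` `]0%R, +oo[).
  apply/cvg_lim => //.
  apply: (nondecreasing_at_right_cvge +oo%O) => // a b.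
  rewrite !in_itv/= !andbT => a0 b0 ab; rewrite !SE//; exact: slope_nd.
congr ereal_inf; apply/seteqP; split => y [e /=].
  by rewrite in_itv/= andbT => e0 <-; exists e => //; rewrite SE.
by move=> e0 <-; exists e; rewrite /= ?in_itv ?andbT//= SE.
Qed.

Lemma lip_le_slope r u z : (0 < r)%R -> lip u z <= slope r u z.
Proof. by move=> r0; rewrite lip_ereal_inf; apply: ereal_inf_lbound; exists r. Qed.

Lemma lip_ge0 u z : 0 <= lip u z.
Proof.
by rewrite lip_ereal_inf; apply: le_ereal_inf_tmp => _ [e _ <-]; exact: slope_ge0.
Qed.

Lemma cvg_slope_lip u z : slope n.+1%:R^-1 u z @[n --> \oo] --> lip u z.
Proof.
have -> : lip u z = ereal_inf (range (fun n => slope n.+1%:R^-1 u z)).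
  apply/eqP; rewrite eq_le; apply/andP; split.
    by apply: le_ereal_inf_tmp => _ [n _ <-]; exact: lip_le_slope.
  rewrite lip_ereal_inf; apply: le_ereal_inf_tmp => _ [e e0 <-].
  apply: ge_ereal_inf; exists (slope (Num.truncn e^-1).+1%:R^-1 u z) => //.
  apply: slope_nd; rewrite invf_ple ?posrE//.
  by rewrite ltW// Num.Theory.truncnS_gt.
apply: ereal_nonincreasing_cvgn => n m nm; apply: slope_nd.
by rewrite lef_pV2 ?posrE// ler_nat ltnS.
Qed.

Lemma Lipschitz_continuous u : Lipschitz u -> continuous u.
Proof.
move=> [K uK] z; apply/cvgrPdist_lt => e e0.
near=> t; apply: (le_lt_trans (uK _ _)).
have zt : (mdist z t < e / (`|K| + 1))%R.
  near: t; apply/metricType_numDomainType.nbhs_mdistP.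
  by exists (e / (`|K| + 1))%R => //=; rewrite divr_gt0// ltr_wpDl.
move: zt; rewrite ltr_pdivlMr ?ltr_wpDl//.
apply: le_lt_trans.
have := mdist_ge0 z t; have := ler_norm K => ? ?; nra.
Unshelve. all: by end_near. Qed.

Lemma open_borel (A : set X) : open A ->
  measurable (A : set (g_sigma_algebraType (@open X))).
Proof. by move=> oA; exact: sub_sigma_algebra. Qed.

Lemma lsc_measurable d (T : measurableType d) (f : T -> \bar R) :
  (forall a : R, measurable [set z | a%:E < f z]) -> measurable_fun setT f.
Proof.
move=> fo; apply: (measurability _ (ErealGenOInfty.measurableE R)).
move=> _ [_ [r ->] <-]; rewrite setTI.
rewrite (_ : _ @^-1` _ = [set z | r%:E < f z])//.
by apply/seteqP; split => z /=; rewrite in_itv/= andbT.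
Qed.

Lemma borel_nonneg_slope r u : continuous u -> borel_nonneg (slope r u).
Proof.
move=> uc; split; first exact: slope_ge0.
apply: lsc_measurable => a; apply: open_borel; exact: open_slope_gt.
Qed.

Lemma chain_integral_cons (g : X -> \bar R) q q' s :
  chain_integral g q (q' :: s) =
  (g q + g q') / 2%:E * (mdist q q')%:E + chain_integral g q' s.
Proof. by rewrite /chain_integral /= big_cons. Qed.

(** If g controls the increments of u from both ends of a step, then so does the mean
    of its two values. *)
Lemma eps_chain_le_UG_eps (e : R) u (g : X -> \bar R) : (forall z, 0 <= g z) ->
  (forall a b, (mdist a b <= e)%R -> `|u b - u a|%:E <= g a * (mdist a b)%:E) ->
  forall q s, eps_chain e q s -> `|u (last q s) - u q|%:E <= chain_integral g q s.
Proof.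
move=> g0 ug q s; elim: s q => [q _|q' s ih q /= /andP[qq' qs]].
  by rewrite subrr normr0 /chain_integral/= big_nil.
rewrite chain_integral_cons.
apply: (@le_trans _ _ (`|u q' - u q|%:E + `|u (last q' s) - u q'|%:E)).
  rewrite -EFinD lee_fin.
  by rewrite (_ : _ - _ = (u q' - u q) + (u (last q' s) - u q'))%R ?ler_normD//; lra.
apply: leeD; last exact: ih.
have h1 := ug _ _ qq'.
have h2 : `|u q' - u q|%:E <= g q' * (mdist q q')%:E.
  by rewrite distrC metric_sym; apply: ug; rewrite metric_sym.
move: (mdist q q') (`|u q' - u q|%R) h1 h2 (mdist_ge0 q q') => D U h1 h2.
rewrite le_eqVlt => /predU1P[D0|D0]; first by rewrite -D0 !mule0 in h1 *.
move: h1 h2.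
case: (g q) (g0 q) => [a a0| |//]; case: (g q') (g0 q') => [b b0| |//] h1 h2.
- rewrite -!EFinM !lee_fin in h1 h2.
  by rewrite inver pnatr_eq0/= -EFinD -!EFinM lee_fin; lra.
all: by rewrite ?addey ?addye// inver pnatr_eq0/= !gt0_mulye ?leey ?lte_fin.
Qed.

End slopes.

(** * Length of curves and parametrization by arc length *)

Section curve_length.
Context {R : realType} {X : completeMetricType R}.
Implicit Types (f : R -> X) (a b c : R) (ts : seq R).

Definition polygon_length f a ts : R :=
  (\sum_(l <- pairmap (fun t t' => mdist (f t) (f t')) a ts) l)%R.

Lemma polygon_length_cons f a t ts :
  polygon_length f a (t :: ts) =
  (mdist (f a) (f t) + polygon_length f t ts)%R.
Proof. by rewrite /polygon_length /= big_cons. Qed.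

Lemma polygon_length_nil f a : polygon_length f a [::] = 0%R.
Proof. by rewrite /polygon_length /= big_nil. Qed.

Lemma polygon_length_cat f a ts ts' : polygon_length f a (ts ++ ts') =
  (polygon_length f a ts + polygon_length f (last a ts) ts')%R.
Proof. by rewrite /polygon_length pairmap_cat big_cat. Qed.

Lemma polygon_length_le f a b ts : itv_partition a b ts ->
  (polygon_length f a ts)%:E <= curve_length f a b.
Proof. by move=> tsP; apply: ereal_sup_ubound; exists ts. Qed.

Lemma itv_partition_exists a b : (a <= b)%R -> exists ts, itv_partition a b ts.
Proof.
rewrite le_eqVlt => /predU1P[<-|ab]; first by exists [::]; split => /=.
by exists [:: b]; exact: itv_partition1.
Qed.

Lemma mdist_le_curve_length f a b : (a <= b)%R ->
  (mdist (f a) (f b))%:E <= curve_length f a b.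
Proof.
rewrite le_eqVlt => /predU1P[<-|ab].
  rewrite mdistxx -(polygon_length_nil f a).
  by apply: polygon_length_le; split => /=.
rewrite -[mdist _ _]addr0 -(polygon_length_nil f b) -polygon_length_cons.
exact/polygon_length_le/itv_partition1.
Qed.

Lemma curve_length_ge0 f a b : (a <= b)%R -> 0 <= curve_length f a b.
Proof.
move=> ab; apply: le_trans (mdist_le_curve_length f ab).
by rewrite lee_fin mdist_ge0.
Qed.

Lemma curve_length_superadditive f a c b : (a <= c)%R -> (c <= b)%R ->
  curve_length f a c + curve_length f c b <= curve_length f a b.
Proof.
move=> ac cb; have [loo|loo] := leP +oo (curve_length f a b).
  by rewrite (le_trans (leey _) loo).
have ab := le_trans ac cb.
have lfin : curve_length f a b \is a fin_num.
  by rewrite ge0_fin_numE// curve_length_ge0.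
have H s t : itv_partition a c s -> itv_partition c b t ->
    (polygon_length f a s)%:E + (polygon_length f c t)%:E <= curve_length f a b.
  move=> sP tP; rewrite -EFinD.
  have -> : c = last a s by case: sP => _ /eqP.
  rewrite -polygon_length_cat; apply: polygon_length_le.
  exact: itv_partition_cat tP.
have H1 t : itv_partition c b t ->
    curve_length f a c <= curve_length f a b - (polygon_length f c t)%:E.
  move=> tP; apply: ge_ereal_sup => _ [s sP <-].
  by rewrite leeBrDr//; exact: H.
have acfin : curve_length f a c \is a fin_num.
  have [t tP] := itv_partition_exists cb.
  rewrite ge0_fin_numE ?curve_length_ge0//; apply: (le_lt_trans (H1 _ tP)).
  by rewrite -(fineK lfin) -EFinB ltry.
rewrite addeC -leeBrDr//; apply: ge_ereal_sup => _ [t tP <-].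
by rewrite leeBrDr// addeC -leeBrDr//; exact: H1.
Qed.

(** Inserting the vertex c in a polygon does not shorten it, and splits it into a
    polygon of [a, c] and one of [c, b]. *)
Lemma curve_length_additive f a c b : (a <= c)%R -> (c <= b)%R ->
  curve_length f a b = curve_length f a c + curve_length f c b.
Proof.
move=> ac cb; apply/eqP; rewrite eq_le curve_length_superadditive// andbT.
apply: ge_ereal_sup => _ [ts tsP <-]; rewrite -/(polygon_length _ _ _).
elim: ts a ac tsP => [a ac /itv_partition_nil ab|t ts ih a ac tsP].
  by rewrite polygon_length_nil adde_ge0// curve_length_ge0.
rewrite polygon_length_cons.
have tsP' := itv_partition_cons tsP.
have at_ : (a < t)%R by case: tsP => /= /andP[].
have [tc|ct] := leP t c.
  rewrite EFinD; apply: (le_trans (leeD (lexx _) (ih _ tc tsP'))).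
  rewrite addeA leeD2r//.
  apply: le_trans (curve_length_superadditive f (ltW at_) tc).
  by rewrite leeD2r// mdist_le_curve_length// ltW.
apply: (@le_trans _ _ ((mdist (f a) (f c))%:E + (polygon_length f c (t :: ts))%:E)).
  by rewrite polygon_length_cons -EFinD lee_fin addrA lerD2r metric_triangle.
apply: leeD; first exact: mdist_le_curve_length.
by apply: polygon_length_le; case: tsP' => tsp ?; split => //=; rewrite ct.
Qed.

Lemma curve_length_le f a b (k : R) : (a <= b)%R ->
  (forall t t', (a <= t)%R -> (t <= t')%R -> (t' <= b)%R ->
     (mdist (f t) (f t') <= k * (t' - t))%R) ->
  curve_length f a b <= (k * (b - a))%:E.
Proof.
move=> ab fk; apply: ge_ereal_sup => _ [ts tsP <-].
rewrite -/(polygon_length _ _ _) lee_fin.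
elim: ts a ab fk tsP => [a ab fk /itv_partition_nil ->|t ts ih a ab fk tsP].
  by rewrite polygon_length_nil subrr mulr0.
have tsP' := itv_partition_cons tsP.
have at_ : (a < t)%R by case: tsP => /= /andP[].
have tb := itv_partition_le tsP'.
rewrite polygon_length_cons.
have := fk a t (lexx _) (ltW at_) tb.
have fk' t1 t2 : (t <= t1)%R -> (t1 <= t2)%R -> (t2 <= b)%R ->
     (mdist (f t1) (f t2) <= k * (t2 - t1))%R.
  by move=> tt1; apply: fk; rewrite (le_trans (ltW at_)).
by have := ih _ tb fk' tsP'; lra.
Qed.

(** Lengths are continuous on the left: in a nearly optimal polygon of [a, t], moving
    the last vertex from t to s costs at most the distance of f s and f t. *)
Lemma curve_length_near_left f a t (e : R) :
  (a < t)%R -> rectifiable f a t -> {within `[a, t], continuous f} ->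
  (0 < e)%R -> exists2 d : R, (0 < d)%R & forall s, (a <= s)%R -> (s <= t)%R ->
    (t - d < s)%R -> curve_length f a t <= curve_length f a s + e%:E.
Proof.
move=> at_ fin fc e0; have e20 : (0 < e / 2)%R by rewrite divr_gt0.
have lfin : curve_length f a t \is a fin_num.
  by rewrite ge0_fin_numE// curve_length_ge0// ltW.
have [_ [ts tsP <-]] := ub_ereal_sup_adherent e20 lfin.
rewrite -/(curve_length f a t) -/(polygon_length f a ts).
case/lastP: ts tsP => [/itv_partition_nil ab|ts t1 tsP].
  by rewrite ab ltxx in at_.
have t1E : t1 = t by case: tsP => _; rewrite last_rcons => /eqP.
rewrite {}t1E in tsP *.
rewrite -cats1 polygon_length_cat polygon_length_cons polygon_length_nil addr0.
set q := last a ts => tsl.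
have [tsp qt] : path <%R a ts /\ (q < t)%R.
  by case: tsP; rewrite rcons_path => /andP[].
have /subspace_continuousP/(_ t) := fc.
rewrite /= in_itv/= lexx andbT => /(_ (ltW at_)).
move=> /metricType_numDomainType.cvgrPdist_lt/(_ _ e20).
rewrite near_withinE => /nbhs_ballP[d /= d0 dP].
exists (Num.min d (t - q))%R; first by rewrite lt_min d0 subr_gt0.
move=> s as_ st sd; have [->|st'] := eqVneq s t; first by rewrite leeDl// lee_fin ltW.
have [sd1 sq] : (t - d < s)%R /\ (q < s)%R.
  have := ge_min d d (t - q)%R; have := ge_min (t - q)%R d (t - q)%R.
  by rewrite !lexx orbT => /= ? ?; split; lra.
have dst : (mdist (f t) (f s) < e / 2)%R.
  apply: dP; last by rewrite /= in_itv/= as_.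
  by rewrite /ball/= ger0_norm ?subr_ge0//; lra.
have sl : (polygon_length f a (ts ++ [:: s]))%:E <= curve_length f a s.
  by apply: polygon_length_le; rewrite cats1; split; rewrite ?rcons_path ?tsp ?last_rcons.
rewrite lteBlDr// in tsl; apply: (le_trans (ltW tsl)).
apply: le_trans (leeD sl (lexx _)).
rewrite polygon_length_cat polygon_length_cons polygon_length_nil -!EFinD lee_fin.
by have := metric_triangle (f q) (f s) (f t); rewrite (metric_sym (f s)); lra.
Qed.

(** The symmetric statement, in which the first vertex of the polygon moves. *)
Lemma curve_length_near_right f t b (e : R) :
  (t < b)%R -> rectifiable f t b -> {within `[t, b], continuous f} ->
  (0 < e)%R -> exists2 d : R, (0 < d)%R & forall s, (t <= s)%R -> (s <= b)%R ->
    (s < t + d)%R -> curve_length f t b <= curve_length f s b + e%:E.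
Proof.
move=> tb fin fc e0; have e20 : (0 < e / 2)%R by rewrite divr_gt0.
have lfin : curve_length f t b \is a fin_num.
  by rewrite ge0_fin_numE// curve_length_ge0// ltW.
have [_ [ts tsP <-]] := ub_ereal_sup_adherent e20 lfin.
rewrite -/(curve_length f t b) -/(polygon_length f t ts).
case: ts tsP => [/itv_partition_nil ab|q ts tsP]; first by rewrite ab ltxx in tb.
rewrite polygon_length_cons => tsl.
have [tq tsp tsb] : [/\ (t < q)%R, path <%R q ts & last q ts == b].
  by case: tsP => /= /andP[].
have /subspace_continuousP/(_ t) := fc.
rewrite /= in_itv/= lexx => /(_ (ltW tb)).
move=> /metricType_numDomainType.cvgrPdist_lt/(_ _ e20).
rewrite near_withinE => /nbhs_ballP[d /= d0 dP].
exists (Num.min d (q - t))%R; first by rewrite lt_min d0 subr_gt0.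
move=> s ts_ sb sd.
have [sd1 sd2] : (s < t + d)%R /\ (s < q)%R.
  have := ge_min d d (q - t)%R; have := ge_min (q - t)%R d (q - t)%R.
  by rewrite !lexx orbT => /= ? ?; split; lra.
have dst : (mdist (f t) (f s) < e / 2)%R.
  apply: dP; last by rewrite /= in_itv/= ts_.
  by rewrite /ball/= distrC ger0_norm ?subr_ge0//; lra.
have sl : (polygon_length f s (q :: ts))%:E <= curve_length f s b.
  by apply: polygon_length_le; split => //=; rewrite sd2.
rewrite lteBlDr// in tsl; apply: (le_trans (ltW tsl)).
apply: le_trans (leeD sl (lexx _)).
rewrite polygon_length_cons -!EFinD lee_fin.
by have := metric_triangle (f t) (f s) (f q); lra.
Qed.

End curve_length.

Section arc_length.
Context {R : realType} {X : completeMetricType R}.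
Variables (f : R -> X) (a b : R).
Hypotheses (fc : curve f a b) (fr : rectifiable f a b).

Let ab : (a <= b)%R := fc.1.

Lemma curve_length_fin_num s t : (a <= s)%R -> (s <= t)%R -> (t <= b)%R ->
  curve_length f s t \is a fin_num.
Proof.
move=> as_ st tb; rewrite ge0_fin_numE ?curve_length_ge0//.
apply: le_lt_trans fr.
rewrite (curve_length_additive f as_ (le_trans st tb)).
rewrite (curve_length_additive f st tb).
rewrite (le_trans _ (leeDr _ (curve_length_ge0 f as_)))//.
by rewrite leeDl// curve_length_ge0.
Qed.

Definition arc_length t : R := fine (curve_length f a t).

Lemma arc_lengthB s t : (a <= s)%R -> (s <= t)%R -> (t <= b)%R ->
  (arc_length t - arc_length s)%:E = curve_length f s t.
Proof.
move=> as_ st tb; have sb := le_trans st tb.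
have at_ := le_trans as_ st.
have sfin := curve_length_fin_num (lexx a) as_ sb.
have tfin := curve_length_fin_num (lexx a) at_ tb.
rewrite EFinB !fineK// (curve_length_additive f as_ st) addeAC subee ?add0e//.
Qed.

Lemma arc_length_nd s t : (a <= s)%R -> (s <= t)%R -> (t <= b)%R ->
  (arc_length s <= arc_length t)%R.
Proof.
move=> as_ st tb; rewrite -subr_ge0 -lee_fin arc_lengthB//.
exact: curve_length_ge0.
Qed.

Lemma mdist_le_arc_length s t : (a <= s)%R -> (s <= t)%R -> (t <= b)%R ->
  (mdist (f s) (f t) <= arc_length t - arc_length s)%R.
Proof.
move=> as_ st tb; rewrite -lee_fin arc_lengthB//.
exact: mdist_le_curve_length.
Qed.

Lemma arc_length_a : arc_length a = 0%R.
Proof.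
have := @arc_lengthB a a (lexx _) (lexx _) ab.
rewrite subrr /arc_length => <- //.
Qed.

Lemma arc_length_continuous : {within `[a, b], continuous arc_length}.
Proof.
apply/subspace_continuousP => t; rewrite /= in_itv/= => /andP[at_ tb].
apply/cvgrPdist_le => e e0; rewrite near_withinE.
have fct c d : (a <= c)%R -> (d <= b)%R -> {within `[c, d], continuous f}.
  move=> ac db; apply: continuous_subspaceW fc.2.
  by apply: subset_itv; rewrite bnd_simp.
have [d1 d10 H1] : exists2 d : R, (0 < d)%R & forall s, (a <= s)%R ->
    (s <= t)%R -> (t - d < s)%R -> (arc_length t - arc_length s <= e)%R.
  have [<-|at'] := eqVneq a t.
    exists 1%R => // s as_ sa _; have -> : s = a by apply/eqP; rewrite eq_le as_ sa.
    by rewrite subrr ltW.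
  have {}at' : (a < t)%R by rewrite lt_neqAle at'.
  have [|d d0 H] := curve_length_near_left at' _ (fct _ _ (lexx _) tb) e0.
    by rewrite /rectifiable -ge0_fin_numE ?curve_length_ge0// curve_length_fin_num.
  exists d => // s as_ st ds; rewrite -lee_fin arc_lengthB//.
  have := H s as_ st ds; rewrite (curve_length_additive f as_ st).
  by rewrite leeD2lE// curve_length_fin_num// (le_trans st).
have [d2 d20 H2] : exists2 d : R, (0 < d)%R & forall s, (t <= s)%R ->
    (s <= b)%R -> (s < t + d)%R -> (arc_length s - arc_length t <= e)%R.
  have [->|tb'] := eqVneq t b.
    exists 1%R => // s as_ sa _; have -> : s = b by apply/eqP; rewrite eq_le as_ sa.
    by rewrite subrr ltW.
  have {}tb' : (t < b)%R by rewrite lt_neqAle tb'.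
  have [|d d0 H] := curve_length_near_right tb' _ (fct _ _ at_ (lexx _)) e0.
    by rewrite /rectifiable -ge0_fin_numE ?curve_length_ge0// curve_length_fin_num.
  exists d => // s ts_ sb ds; rewrite -lee_fin arc_lengthB//.
  have := H s ts_ sb ds; rewrite (curve_length_additive f ts_ sb) addeC.
  by rewrite leeD2lE// curve_length_fin_num// (le_trans at_).
apply/nbhs_ballP; exists (Num.min d1 d2); first by rewrite /= lt_min d10.
move=> s; rewrite /ball/= lt_min => /andP[] h1 h2; rewrite in_itv/= => /andP[as_ sb].
have [st|ts_] := leP s t.
  rewrite ger0_norm ?subr_ge0 ?arc_length_nd// H1//.
  by move: h1; rewrite ger0_norm ?subr_ge0//; lra.
rewrite distrC ger0_norm ?subr_ge0 ?arc_length_nd ?(ltW ts_)// H2 ?(ltW ts_)//.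
by move: h2; rewrite distrC ger0_norm ?subr_ge0 ?(ltW ts_)//; lra.
Qed.

Lemma arc_length_surj (tau : R) : (0 <= tau)%R -> (tau <= arc_length b)%R ->
  exists2 t, t \in `[a, b] & arc_length t = tau.
Proof.
move=> tau0 taub; apply: IVT => //; first exact: arc_length_continuous.
by rewrite arc_length_a ge_min tau0 le_max taub orbT.
Qed.

Let P := arc_length_param f a b.

Lemma arc_length_paramP (tau : R) : (0 <= tau)%R -> (tau <= arc_length b)%R ->
  exists t, [/\ (a <= t)%R, (t <= b)%R, arc_length t = tau & P tau = f t].
Proof.
move=> tau0 taub; rewrite /P /arc_length_param; case: xgetP => [t tE|].
  rewrite /= in_itv/= => -[/andP[at_ tb] lt].
  by exists t; split => //; rewrite /arc_length lt.
have [t /[dup] + + lt H] := arc_length_surj tau0 taub.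
rewrite in_itv/= => /andP[at_ tb] tab.
by exfalso; apply: (H t); split => //; rewrite -lt fineK// curve_length_fin_num.
Qed.

(** The two points are images of parameters between which f has run exactly the
    length t - s. *)
Lemma mdist_arc_length_param (s t : R) : (0 <= s)%R -> (s <= t)%R ->
  (t <= arc_length b)%R -> (mdist (P s) (P t) <= t - s)%R.
Proof.
move=> s0 st tb.
have [s' [as' s'b ls ->]] := arc_length_paramP s0 (le_trans st tb).
have [t' [at' t'b lt ->]] := arc_length_paramP (le_trans s0 st) tb.
have [s't'|/ltW t's'] := leP s' t'.
  by rewrite -lt -ls mdist_le_arc_length.
rewrite metric_sym; apply: (le_trans (mdist_le_arc_length at' t's' s'b)); lra.
Qed.

Lemma arc_length_paramE t : (a <= t)%R -> (t <= b)%R -> P (arc_length t) = f t.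
Proof.
move=> at_ tb.
have [|//|s [as_ sb ls ->]] := @arc_length_paramP (arc_length t).
- by rewrite -arc_length_a arc_length_nd.
- by rewrite arc_length_nd.
apply: mdist_positivity; apply/eqP; rewrite eq_le mdist_ge0 andbT.
have [st|/ltW ts] := leP s t.
  by apply: (le_trans (mdist_le_arc_length as_ st tb)); rewrite ls subrr.
rewrite metric_sym.
by apply: (le_trans (mdist_le_arc_length at_ ts sb)); rewrite ls subrr.
Qed.

(** The parametrization is 1-Lipschitz on its interval, hence pulls open sets back to
    relatively open ones. *)
Lemma measurable_arc_length_param (g : X -> \bar R) :
  measurable_fun setT (g : g_sigma_algebraType (@open X) -> \bar R) ->
  measurable_fun `[0%R, arc_length b] (g \o P).
Proof.
move=> mg.
suff mP : measurable_fun `[0%R, arc_length b]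
    (P : R -> g_sigma_algebraType (@open X)) by exact: measurableT_comp mg mP.
apply: (@measurability _ _ _ (g_sigma_algebraType (@open X)) _ _ (@open X)) => //.
move=> _ [U oU <-].
pose V := \bigcup_(t in [set t | t \in `[0%R, arc_length b] /\ U (P t)])
  \bigcup_(e in [set e : R | (0 < e)%R /\ ball (P t) e `<=` U]) ball t e.
suff -> : `[0%R, arc_length b] `&` P @^-1` U = `[0%R, arc_length b] `&` V.
  apply: measurableI => //; apply: open_measurable.
  by apply: bigcup_open => t _; apply: bigcup_open => e _; exact: ball_open.
apply/seteqP; split => t [tl tU]; split => //.
  have /nbhs_ballP[e e0 eU] : nbhs (P t) U by exact: open_nbhs_nbhs.
  by exists t => //; exists e => //; exact: ballxx.
case: tU => s [sl Us] [e [e0 eU]]; rewrite /ball/= => ts; apply: eU.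
rewrite ballEmdist/=.
move: tl sl; rewrite /= !in_itv/= => /andP[t0 tl] /andP[s0 sl].
have [st|/ltW ts'] := leP s t.
  apply: le_lt_trans (mdist_arc_length_param s0 st tl) _.
  by move: ts; rewrite distrC ger0_norm// subr_ge0.
rewrite metric_sym; apply: le_lt_trans (mdist_arc_length_param t0 ts' sl) _.
by move: ts; rewrite ger0_norm// subr_ge0.
Qed.

End arc_length.

Lemma ge0_integral_itv_split {R : realType} (h : R -> \bar R) (s t l : R) :
  (0 <= s)%R -> (s <= t)%R -> (t <= l)%R ->
  measurable_fun `[0%R, l] h -> (forall r, 0 <= h r) ->
  \int[lebesgue_measure]_(r in `[0%R, t]) h r =
  \int[lebesgue_measure]_(r in `[0%R, s]) h r +
  \int[lebesgue_measure]_(r in `]s, t]) h r.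
Proof.
move=> s0 st tl mh h0; rewrite -ge0_integral_setU//.
- congr integral; apply/seteqP; split => r /=; rewrite !in_itv/=.
    by move=> /andP[-> rt]; case: (leP r s) => // _; [left|right].
  move=> [/andP[-> /le_trans->//]|/andP[sr ->]].
  by rewrite (le_trans s0 (ltW sr)).
- apply: measurable_funS mh => // r /=; rewrite !in_itv/=.
  by move=> [/andP[-> rs]|/andP[sr rt]]; apply/andP; split => //; lra.
- rewrite disj_set2E; apply/eqP/seteqP; split => // r [] /=.
  by rewrite !in_itv/= => /andP[_ rs] /andP[sr _]; lra.
Qed.

(** * Chains along a curve *)

Section chains_along_curves.
Context {R : realType} {X : completeMetricType R}.

Lemma chain_integral_rcons (g : X -> \bar R) q s z :
  chain_integral g q (rcons s z) = chain_integral g q s +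
    (g (last q s) + g z) / 2%:E * (mdist (last q s) z)%:E.
Proof.
rewrite /chain_integral -cats1 pairmap_cat big_cat/= big_cons big_nil.
by rewrite adde0.
Qed.

Lemma chain_integral_rcons_le (g : X -> \bar R) q s z (A B B' D : R) :
  (forall z, 0 <= g z) ->
  chain_integral g q s <= A%:E -> g (last q s) <= B%:E -> g z <= B'%:E ->
  (mdist (last q s) z <= D)%R ->
  chain_integral g q (rcons s z) <= (A + (B + B') / 2 * D)%:E.
Proof.
move=> g0 sA gB gB' zD.
rewrite chain_integral_rcons [leRHS]EFinD; apply: leeD => //.
rewrite [leRHS]EFinM lee_pmul//.
- by rewrite mule_ge0// ?adde_ge0// inver pnatr_eq0/= lee_fin.
- by rewrite lee_fin mdist_ge0.
- rewrite inver pnatr_eq0/= [leRHS]EFinM lee_wpmul2r ?lee_fin//.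
  by rewrite EFinD leeD.
Qed.

Lemma chain_length_rcons (q : X) s z :
  chain_length q (rcons s z) = (chain_length q s + mdist (last q s) z)%R.
Proof.
by rewrite /chain_length -cats1 pairmap_cat big_cat/= big_cons big_nil addr0.
Qed.

Variables (f : R -> X) (a b : R) (g : X -> \bar R).
Hypotheses (fc : curve f a b) (fr : rectifiable f a b) (gb : borel_nonneg g).
Hypothesis (gfin : curve_integral g f a b < +oo).

Let P := arc_length_param f a b.
Let l := arc_length f a b.

Let l0 : (0 <= l)%R.
Proof.
rewrite -(arc_length_a fc fr).
by apply: (arc_length_nd fr) => //; exact: fc.1.
Qed.

Let primitive t := \int[lebesgue_measure]_(tau in `[0%R, t]) g (P tau).

Let primitive_fin t : (t <= l)%R -> primitive t \is a fin_num.
Proof.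
move=> tl; rewrite ge0_fin_numE; last by apply: integral_ge0 => tau _; exact: gb.1.
apply: le_lt_trans gfin; apply: ge0_subset_integral => //.
- exact: (measurable_arc_length_param fc fr gb.2).
- by move=> tau _; exact: gb.1.
- by apply: subset_itv; rewrite bnd_simp.
Qed.

(** On the interval from s to t the function takes a value that exceeds its mean by
    arbitrarily little. *)
Let small_value (s t e : R) : (0 <= s)%R -> (s < t)%R -> (t <= l)%R -> (0 < e)%R ->
  exists2 tau : R, (s < tau <= t)%R &
    g (P tau) <= ((fine (primitive t) - fine (primitive s) + e) / (t - s))%:E.
Proof.
move=> s0 st tl e0; apply: contrapT => H.
set c := (_ / _)%R in H.
have mgP : measurable_fun `[0%R, l] (g \o P).
  exact: (measurable_arc_length_param fc fr gb.2).
have sfin := primitive_fin (ltW (lt_le_trans st tl)).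
have tfin := primitive_fin tl.
have prim0 r : (0 <= fine (primitive r))%R.
  by rewrite fine_ge0//; apply: integral_ge0 => tau _; exact: gb.1.
have ms : measurable_fun `]s, t] (g \o P).
  by apply: measurable_funS mgP => //; apply: subset_itv; rewrite bnd_simp.
have split_ : primitive t =
    primitive s + \int[lebesgue_measure]_(tau in `]s, t]) g (P tau).
  by apply: (ge0_integral_itv_split s0 (ltW st) tl mgP) => r; exact: gb.1.
have ge_c : (c * (t - s))%:E <= \int[lebesgue_measure]_(tau in `]s, t]) g (P tau).
  have [c0|c0] := ltP c 0%R.
    apply: (@le_trans _ _ 0); first by rewrite lee_fin; nra.
    by apply: integral_ge0 => tau _; exact: gb.1.
  apply: (@le_trans _ _ (\int[lebesgue_measure]_(tau in `]s, t]) c%:E)).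
    rewrite integral_cst//= lebesgue_measure_itv/= lte_fin st.
    by rewrite -EFinB -EFinM.
  apply: ge0_le_integral => //.
  move=> tau; rewrite /= in_itv/= => taust; rewrite leNgt; apply/negP => lt.
  by apply: H; exists tau => //; exact: ltW.
move: ge_c; rewrite leNgt => /negP; apply.
have -> : \int[lebesgue_measure]_(tau in `]s, t]) g (P tau) =
   (fine (primitive t) - fine (primitive s))%:E.
  by rewrite EFinB !fineK// split_ addeAC subee ?add0e.
rewrite lte_fin /c divfK ?gt_eqF ?subr_gt0//; lra.
Qed.

(** Cut the interval of arc length into N pieces of length h, and visit in each piece
    a point where g is at most about its mean. Consecutive points are at distance at
    most 2 h, so that each value of g enters the sum with weight at most 2 h: this
    gives the factor 2. The values at the two end points are finite and contribute
    a multiple of h. An exact Riemann sum would need shifted partitions; the factor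
    is harmless because it is absorbed by the constants. *)
Lemma curve_chain (e eta : R) : g (f a) < +oo -> g (f b) < +oo ->
  (0 < e)%R -> (0 < eta)%R -> exists s, [/\ chains e (f a) (f b) s,
    (chain_length (f a) s)%:E <= curve_length f a b &
    chain_integral g (f a) s <= 2%:E * curve_integral g f a b + eta%:E].
Proof.
move=> gafin gbfin e0 eta0.
have ab := fc.1.
have lE : curve_length f a b = l%:E by rewrite /l /arc_length fineK// (curve_length_fin_num fr).
have Pa : P 0%R = f a by rewrite -(arc_length_a fc fr) /P (arc_length_paramE fc fr).
have Pb : P l = f b by rewrite /P (arc_length_paramE fc fr).
have [l00|lpos] := eqVneq l 0%R.
  exists [::]; split.
  - by split => //=; rewrite -Pa -Pb l00.
  - by rewrite /chain_length/= big_nil curve_length_ge0.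
  - rewrite /chain_integral/= big_nil adde_ge0 ?lee_fin ?(ltW eta0)//.
    by rewrite mule_ge0//; apply: integral_ge0 => tau _; exact: gb.1.
have {}lpos : (0 < l)%R by rewrite lt_neqAle eq_sym lpos.
have [ga ga0 gaE] : exists2 r : R, (0 <= r)%R & g (f a) = r%:E.
  by move: (gb.1 (f a)) gafin; case: (g (f a)) => // r r0 _; exists r.
have [gb' gb'0 gbE] : exists2 r : R, (0 <= r)%R & g (f b) = r%:E.
  by move: (gb.1 (f b)) gbfin; case: (g (f b)) => // r r0 _; exists r.
have [N N0 [Ne Neta]] : exists2 N : nat, (0 < N)%N &
    (2 * (l / N%:R) <= e)%R /\ (l / N%:R * (ga + gb') <= eta / 2)%R.
  exists (Num.truncn (2 * l / e)%R + Num.truncn (2 * l * (ga + gb') / eta)%R).+1%N => //.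
  set N := (Num.truncn _ + _).+1; have N0 : (0 < N%:R :> R)%R by rewrite ltr0n.
  split.
    have : (2 * l / e <= N%:R)%R.
      apply: (le_trans (ltW (Num.Theory.truncnS_gt _))); rewrite ler_nat.
      by rewrite /N ltnS leq_addr.
    rewrite ler_pdivrMr// => Ne; have -> : (2 * (l / N%:R) = 2 * l / N%:R)%R by rewrite mulrA.
    by rewrite ler_pdivrMr//; lra.
  rewrite mulrAC ler_pdivrMr//.
  have : (2 * l * (ga + gb') / eta <= N%:R)%R.
    apply: (le_trans (ltW (Num.Theory.truncnS_gt _))); rewrite ler_nat.
    by rewrite /N ltnS leq_addl.
  by rewrite ler_pdivrMr//; lra.
set h := (l / N%:R)%R in Ne Neta.
have h0 : (0 < h)%R by rewrite divr_gt0// ltr0n.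
pose th := (eta / (4 * N%:R))%R.
have th0 : (0 < th)%R by rewrite divr_gt0// mulr_gt0// ltr0n.
have key k : (k < N)%N -> exists (s : seq X) (tau A B : R),
    [/\ (h *+ k < tau <= h *+ k.+1)%R, path (fun u v => mdist u v <= e)%R (f a) s,
        last (f a) s = P tau, (chain_length (f a) s <= tau)%R &
    [/\ chain_integral g (f a) s <= A%:E, g (P tau) <= B%:E, (0 <= B)%R &
        (A + h * B <= h * ga + 2 * fine (primitive (h *+ k.+1)) + 2 * (th *+ k.+1))%R]].
  have hN m : (m <= N)%N -> (h *+ m <= l)%R.
    move=> mN; rewrite /h -mulr_natr -mulrA ger_pMr// mulrC ler_pdivrMr ?ltr0n//.
    by rewrite mul1r ler_nat.
  (* B bounds the value of g at the last point, which will be used once more. *)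
  elim: k => [|k ih] kN.
    have [|tau] := @small_value 0%R h th (lexx _) h0 _ th0.
      by have := hN 1%N N0; rewrite mulr1n.
    set c := (_ / _)%R => /andP[tau0 tauh] gc.
    have prim00 : primitive 0%R = 0.
      by rewrite /primitive set_itv1 integral_set1.
    have c0 : (0 <= c)%R by rewrite -lee_fin; exact: le_trans (gb.1 _) gc.
    have hc : (h * c = fine (primitive h) + th)%R.
      by rewrite /c prim00 /= !subr0 mulrC divfK ?gt_eqF.
    have hl : (h <= l)%R by have := hN 1%N N0; rewrite mulr1n.
    have dtau : (mdist (f a) (P tau) <= tau)%R.
      rewrite -Pa -[leRHS]subr0 (mdist_arc_length_param fc fr)//; first exact: ltW.
      exact: le_trans hl.
    exists [:: P tau], tau, (0 + (ga + c) / 2 * h)%R, c; split => //=.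
    - by rewrite mulr0n mulr1n tau0.
    - by rewrite andbT; lra.
    - by rewrite (chain_length_rcons _ [::]) /chain_length/= big_nil add0r.
    - split => //.
      + apply: (@chain_integral_rcons_le _ _ [::]) => //=; first exact: gb.1.
        * by rewrite /chain_integral/= big_nil.
        * by rewrite gaE.
        * exact: le_trans tauh.
      + by rewrite !mulr1n; nra.
  have [s [tau [A [B [/andP[tk tk1] sp sl slen [sA sB B0 AB]]]]]] := ih (ltnW kN).
  have [||||tau' /andP[tk' tk1']] := @small_value (h *+ k.+1)%R (h *+ k.+2)%R th => //.
  - by rewrite mulrn_wge0// ltW.
  - by rewrite ltr_pMn2l.
  - exact: hN.
  set c := (_ / _)%R => gc.
  have c0 : (0 <= c)%R by rewrite -lee_fin; exact: le_trans (gb.1 _) gc.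
  have hE : (h *+ k.+2 - h *+ k.+1 = h)%R by rewrite mulrSr addrAC subrr add0r.
  have hc : (h * c = fine (primitive (h *+ k.+2)) - fine (primitive (h *+ k.+1)) + th)%R.
    by rewrite /c hE mulrC divfK ?gt_eqF.
  have tau0 : (0 <= tau)%R by rewrite (le_trans _ (ltW tk))// mulrn_wge0// ltW.
  have tt' : (tau <= tau')%R by rewrite (le_trans tk1)// ltW.
  have t'l : (tau' <= l)%R by rewrite (le_trans tk1')// hN.
  have dtau : (mdist (P tau) (P tau') <= tau' - tau)%R.
    exact: (mdist_arc_length_param fc fr).
  have hE' : (h *+ k.+2 - h *+ k = 2 * h)%R by rewrite !mulrSr; lra.
  exists (rcons s (P tau')), tau', (A + (B + c) / 2 * (2 * h))%R, c; split => //=.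
  - by rewrite tk' tk1'.
  - by rewrite rcons_path sp sl/=; lra.
  - by rewrite last_rcons.
  - by rewrite chain_length_rcons sl; lra.
  - split => //.
    + apply: chain_integral_rcons_le; rewrite ?sl//; first exact: gb.1.
      by lra.
    + have -> : (th *+ k.+2 = th *+ k.+1 + th)%R by rewrite mulrSr.
      by rewrite mulrDr; lra.
case: N N0 @h @th h0 th0 key Ne Neta => // N _ h th h0 th0 key Ne Neta.
have [s [tau [A [B [/andP[tk tk1] sp sl slen [sA sB B0 AB]]]]]] := key N (ltnSn N).
have hl : (h *+ N.+1 = l)%R by rewrite /h -mulr_natr divfK// pnatr_eq0.
rewrite hl in tk1 AB.
have tau0 : (0 <= tau)%R by rewrite (le_trans _ (ltW tk))// mulrn_wge0// ltW.
have dtau : (mdist (P tau) (f b) <= l - tau)%R.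
  by rewrite -Pb; exact: (mdist_arc_length_param fc fr).
have lh : (l - tau <= h)%R.
  by rewrite -hl mulrSr; lra.
exists (rcons s (f b)); split.
- split; last by rewrite last_rcons.
  by rewrite /eps_chain rcons_path sp sl/=; lra.
- by rewrite chain_length_rcons sl lE lee_fin; lra.
- have -> : curve_integral g f a b = (fine (primitive l))%:E.
    by rewrite fineK ?primitive_fin.
  apply: (@le_trans _ _ (A + (B + gb') / 2 * h)%:E).
    apply: chain_integral_rcons_le; rewrite ?sl ?gbE//; first exact: gb.1.
    exact: le_trans lh.
  rewrite -EFinM -EFinD lee_fin.
  have : (th *+ N.+1 = eta / 4)%R.
    rewrite /th -mulr_natr invfM mulrA mulrVK// unitfE pnatr_eq0//.
  by nra.
Qed.

End chains_along_curves.

Section chain_gradients_and_curves.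
Context {R : realType} {X : completeMetricType R}.
Implicit Types (g : X -> \bar R).

Lemma borel_nonnegZ (k : R) g : (0 <= k)%R ->
  borel_nonneg g -> borel_nonneg (fun z => k%:E * g z).
Proof.
move=> k0 [g0 mg]; split; first by move=> z; rewrite mule_ge0.
exact: measurable_funeM.
Qed.

Lemma curve_integralZ (k : R) g (f : R -> X) a b : (0 <= k)%R ->
  borel_nonneg g -> curve f a b -> rectifiable f a b ->
  curve_integral (fun z => k%:E * g z) f a b = k%:E * curve_integral g f a b.
Proof.
move=> k0 [g0 mg] fc fr; rewrite /curve_integral ge0_integralZl//.
exact: (measurable_arc_length_param fc fr mg).
Qed.

(** Approximate the curve by chains with steps at most e. *)
Lemma UG_of_UG_eps (e : R) (u : X -> R) g : (0 < e)%R ->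
  (forall z, g z < +oo) -> UG_eps e u g -> UG u (fun z => 2%:E * g z).
Proof.
move=> e0 gfin [gb ug]; split; first exact: borel_nonnegZ.
move=> f a b fc fr; rewrite curve_integralZ//.
have I0 : 0 <= curve_integral g f a b.
  by apply: integral_ge0 => t _; exact: gb.1.
have [loo|loo] := leP +oo (curve_integral g f a b).
  have -> : curve_integral g f a b = +oo by apply/eqP; rewrite eq_le leey.
  by rewrite gt0_muley ?lte_fin// leey.
apply/lee_addgt0Pr => eta eta0.
have [s [[sp sl] _ sI]] := curve_chain fc fr gb loo (gfin _) (gfin _) e0 eta0.
by apply: le_trans sI; rewrite -sl; exact: ug.
Qed.

End chain_gradients_and_curves.

(** * Bounded sequences in a complete doubling space *)

Section doubling_proper.
Context {R : realType} {X : completeMetricType R}.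
Variable m : {outer_measure set X -> \bar R}.
Hypotheses (hm : metric_measure_space m) (hD : doubling m).

Lemma measurable_cara (A : set X) :
  measurable (A : set (g_sigma_algebraType (@open X))) -> m.-caratheodory A.
Proof. by move=> mA; case: hm => _ _ [+ _ _ _] _; apply. Qed.

Lemma ball_open_metric (z : X) (r : R) : open (ball z r).
Proof.
rewrite ballEmdist.
have := @open_lt R r => /(open_comp (f := fun w => mdist z w)); apply.
by move=> w _; exact: mdist_continuous.
Qed.

Lemma ball_cara (z : X) (r : R) : m.-caratheodory (ball z r).
Proof. by apply: measurable_cara; apply: open_borel; exact: ball_open_metric. Qed.

Lemma measure_ball_lty (z : X) (r : R) : m (ball z r) < +oo.
Proof.
case: hm => _ _ _; apply; exists (r + r)%R => s t.
rewrite ballEmdist/= => zs zt.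
have := metric_triangle s z t; rewrite (metric_sym s z); lra.
Qed.

Lemma doubling_expn : exists2 CD : R, (1 <= CD)%R & forall (z : X) (r : R) n,
  (0 < r)%R -> m (ball z (2 ^+ n * r)%R) <= (CD ^+ n)%:E * m (ball z r).
Proof.
case: hD => CD CD1 D; exists CD => // z r n r0; elim: n => [|n ih].
  by rewrite !expr0 mul1r mul1e.
rewrite exprS -mulrA; apply: (le_trans (D _ _ _)).
  by rewrite mulr_gt0// exprn_gt0.
rewrite exprS EFinM -muleA; apply: lee_wpmul2l => //.
by rewrite lee_fin (le_trans ler01).
Qed.

(** Otherwise, by doubling, all balls around z are null, and they exhaust X. *)
Lemma measure_ball_gt0 (z : X) (r : R) : (0 < r)%R -> 0 < m (ball z r).
Proof.
move=> r0; rewrite lt_neqAle outer_measure_ge0 andbT eq_sym.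
apply/negP => /eqP B0; case: hm => _ /negP + _ _; apply; apply/eqP.
have [CD CD1 D] := doubling_expn.
have Bn n : m (ball z (2 ^+ n * r)%R) = 0.
  apply/eqP; rewrite eq_le outer_measure_ge0 andbT.
  by apply: (le_trans (D z r n r0)); rewrite B0 mule0.
apply/eqP; rewrite eq_le outer_measure_ge0 andbT.
have -> : [set: X] = \bigcup_n ball z (2 ^+ n * r)%R.
  apply/esym; rewrite -subTset => w _; exists (Num.truncn (mdist z w / r)).+1 => //.
  rewrite ballEmdist/= -ltr_pdivrMr//.
  apply: (lt_le_trans (Num.Theory.truncnS_gt _)).
  set n := _.+1; rewrite -natrX ler_nat; exact/ltnW/ltn_expl.
apply: (le_trans (outer_measure_sigma_subadditive m _)).
by rewrite eseries0// => n _ _; exact: Bn.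
Qed.

(** Around the points of an e-separated subset of the ball, the balls of radius e / 2
    are disjoint, and by doubling each of them has at least a fixed fraction of the
    mass of a larger concentric ball: this bounds the number of points. *)
Lemma ball_totally_bounded (z : X) (r e : R) : (0 < r)%R -> (0 < e)%R ->
  exists s : seq X, forall w, ball z r w -> exists2 q, q \in s & (mdist q w < e)%R.
Proof.
move=> r0 e0; apply: contrapT => H.
have e20 : (0 < e / 2)%R by rewrite divr_gt0.
have sep n : exists s : seq X, [/\ size s = n, {in s, forall q, ball z r q} &
    pairwise (fun q w => (e <= mdist w q)%R) s].
  elim: n => [|n [s [sn sz ss]]]; first by exists [::].
  have [w zw sw] : exists2 w, ball z r w & {in s, forall q, (e <= mdist q w)%R}.
    apply: contrapT => K; apply: H; exists s => w zw.
    apply: contrapT => L; apply: K; exists w => // q qs.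
    by rewrite leNgt; apply/negP => qw; apply: L; exists q.
  exists (w :: s); split => /=; first by rewrite sn.
    by move=> q; rewrite inE => /predU1P[->//|]; exact: sz.
  by rewrite ss andbT; apply/allP => q qs; exact: sw.
have [CD CD1 D] := doubling_expn.
pose B0 := ball z (r + e)%R.
(* after k doublings a ball of radius e / 2 around a point of the ball covers B0 *)
have [k kP] : exists k, (2 * r + e <= 2 ^+ k * (e / 2))%R.
  exists (Num.truncn ((2 * r + e) / (e / 2))%R).+1.
  rewrite -ler_pdivrMr//; apply: (le_trans (ltW (Num.Theory.truncnS_gt _))).
  set n := _.+1; rewrite -natrX ler_nat; exact/ltnW/ltn_expl.
have CDk : (0 < CD ^+ k)%R by rewrite exprn_gt0// (lt_le_trans ltr01).
have Bfin : m B0 \is a fin_num.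
  by rewrite ge0_fin_numE ?outer_measure_ge0// measure_ball_lty.
have Bpos : 0 < m B0 by apply: measure_ball_gt0; lra.
have small q : ball z r q -> m B0 <= (CD ^+ k)%:E * m (ball q (e / 2)%R).
  move=> zq; apply: le_trans (D q _ k e20); apply: le_outer_measure => w.
  move: zq; rewrite /B0 !ballEmdist/= => zq zw.
  by have := metric_triangle q z w; rewrite (metric_sym q z); lra.
pose U (s : seq X) := [set w | exists2 q, q \in s & (mdist q w < e / 2)%R].
have sum_le s : {in s, forall q, ball z r q} ->
    pairwise (fun q w => (e <= mdist w q)%R) s ->
    (size s)%:R%:E * m B0 <= (CD ^+ k)%:E * m (U s).
  elim: s => [_ _|q s ih sz /= /andP[/allP qs ss]].
    by rewrite mul0e mule_ge0// ?outer_measure_ge0// lee_fin ltW.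
  rewrite (ball_cara q (e / 2) (U (q :: s))).
  have -> : U (q :: s) `&` ball q (e / 2)%R = ball q (e / 2)%R.
    apply/setIidPr => w; rewrite ballEmdist/= => qw.
    by exists q => //; rewrite mem_head.
  have -> : U (q :: s) `&` ~` ball q (e / 2)%R = U s.
    apply/seteqP; split => [w [[q']]|w [q' q's q'w]].
      by rewrite inE => /predU1P[->|q's q'w _]; [rewrite ballEmdist|exists q'].
    split; first by exists q' => //; rewrite inE q's orbT.
    rewrite ballEmdist/= => qw; have := qs _ q's.
    by have := metric_triangle q' w q; rewrite (metric_sym w); lra.
  rewrite muleDr ?ge0_adde_def ?inE ?outer_measure_ge0//.
  have -> : (size s).+1%:R%:E * m B0 = m B0 + (size s)%:R%:E * m B0.
    by rewrite -{2}(fineK Bfin) -[in LHS](fineK Bfin) -[in RHS](fineK Bfin) -!EFinM -EFinD -natr1; congr EFin; ring.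
  apply: leeD; first by apply: small; apply: sz; rewrite mem_head.
  by apply: ih => // q' q's; apply: sz; rewrite inE q's orbT.
have UB s : {in s, forall q, ball z r q} -> U s `<=` B0.
  move=> sz w [q /sz]; rewrite /B0 !ballEmdist/= => zq qw.
  by have := metric_triangle z q w; lra.
have [s [sn sz ss]] := sep (Num.truncn (CD ^+ k)).+1.
have := sum_le s sz ss; rewrite leNgt => /negP; apply.
apply: (@le_lt_trans _ _ ((CD ^+ k)%:E * m B0)).
  by apply: lee_wpmul2l; [rewrite lee_fin ltW|exact/le_outer_measure/UB].
rewrite lte_pmul2r// lte_fin sn.
exact: Num.Theory.truncnS_gt.
Qed.

(** One of finitely many balls of radius e contains the sequence along the ultrafilter,
    which is therefore Cauchy. Ultrafilters replace the extraction of a subsequence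
    that converges at all times simultaneously. *)
Lemma bounded_ultra_cvg (F : set_system nat) (FU : UltraFilter F)
    (v : nat -> X) (z : X) (r : R) : (0 < r)%R -> (forall k, ball z r (v k)) ->
  exists w : X, v @ F --> w.
Proof.
move=> r0 vz; have FF : ProperFilter F by exact: ultra_proper.
suff : cauchy_ex (v @ F) by move=> /cauchy_exP/cauchy_cvg/cvg_ex.
move=> e e0; have [s sP] := ball_totally_bounded z r0 e0.
apply: contrapT => H.
have : F [set k | forall q, q \in s -> ~ (mdist q (v k) < e)%R].
  elim: {sP} s => [|q s ih]; first by apply: filterE => k q; rewrite in_nil.
  have Fq : F (~` [set k | (mdist q (v k) < e)%R]).
    have [Fq|//] := in_ultra_setVsetC [set k | (mdist q (v k) < e)%R] FU.
    by exfalso; apply: H; exists q; rewrite /= ballEmdist.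
  apply: filterS2 ih Fq => k ih Fq q'; rewrite inE => /predU1P[->//|].
  exact: ih.
move=> /filter_ex[k /= kP]; have [q qs qv] := sP _ (vz k).
exact: kP qs qv.
Qed.

End doubling_proper.

(** * Cost of chains and potentials *)

Section chain_cost.
Context {R : realType} {X : completeMetricType R}.
Local Open Scope ring_scope.
Implicit Types (g G : X -> R) (q z w : X) (s : seq X).

Definition step_cost g q z : R := (g q + g z) / 2 * mdist q z.

Definition chain_cost g q s : R := \sum_(l <- pairmap (step_cost g) q s) l.

Lemma chain_cost_nil g q : chain_cost g q [::] = 0.
Proof. by rewrite /chain_cost/= big_nil. Qed.

Lemma chain_cost_cons g q z s :
  chain_cost g q (z :: s) = step_cost g q z + chain_cost g z s.
Proof. by rewrite /chain_cost/= big_cons. Qed.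

Lemma chain_cost_rcons g q s z :
  chain_cost g q (rcons s z) = chain_cost g q s + step_cost g (last q s) z.
Proof.
by rewrite /chain_cost -cats1 pairmap_cat big_cat/= big_cons big_nil addr0.
Qed.

Lemma step_cost_ge0 g q z : (forall z, 0 <= g z) -> 0 <= step_cost g q z.
Proof. by move=> g0; rewrite mulr_ge0 ?mdist_ge0// divr_ge0 ?addr_ge0. Qed.

Lemma chain_cost_ge0 g q s : (forall z, 0 <= g z) -> 0 <= chain_cost g q s.
Proof.
move=> g0; elim: s q => [q|z s ih q]; first by rewrite chain_cost_nil.
by rewrite chain_cost_cons addr_ge0// step_cost_ge0.
Qed.

Lemma chain_length_cons q z s :
  chain_length q (z :: s) = mdist q z + chain_length z s.
Proof. by rewrite /chain_length/= big_cons. Qed.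

Lemma chain_length_ge0 q s : 0 <= chain_length q s.
Proof.
elim: s q => [q|z s ih q]; first by rewrite /chain_length/= big_nil.
by rewrite chain_length_cons addr_ge0// mdist_ge0.
Qed.

Lemma mdist_le_chain_length q s z : z \in q :: s -> mdist q z <= chain_length q s.
Proof.
elim: s q => [q|w s ih q].
  by rewrite mem_seq1 => /eqP ->; rewrite mdistxx chain_length_ge0.
rewrite in_cons => /predU1P[->|zs]; first by rewrite mdistxx chain_length_ge0.
rewrite chain_length_cons (le_trans (metric_triangle q w z))//.
by rewrite lerD2l ih.
Qed.

Lemma chain_length_le_cost g (c : R) q s : {in q :: s, forall z, c <= g z} ->
  c * chain_length q s <= chain_cost g q s.
Proof.
elim: s q => [q _|z s ih q gc].
  by rewrite /chain_length/= big_nil mulr0 chain_cost_nil.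
rewrite chain_length_cons chain_cost_cons mulrDr lerD//; last first.
  by apply: ih => w ws; apply: gc; rewrite inE ws orbT.
rewrite /step_cost ler_wpM2r ?mdist_ge0//.
have := gc q (mem_head _ _); have := gc z; rewrite !inE eqxx orbT => /(_ isT).
lra.
Qed.

(** A chain of small cost runs through points near its origin, where a Lipschitz
    minorant of the density is nearly constant. *)
Lemma mdist_le_chain_cost g G (J B : R) q s : 0 <= J ->
  (forall z, 1 <= g z) -> (forall z, G z <= g z) ->
  (forall z w, `|G z - G w| <= J * mdist z w) -> chain_cost g q s <= B ->
  (G q - J * B) * mdist q (last q s) <= B.
Proof.
move=> J0 g1 Gg GJ sB.
have lB : chain_length q s <= B.
  by apply: le_trans sB; rewrite -[leLHS]mul1r chain_length_le_cost.
have B0 : 0 <= B by exact: le_trans (chain_length_ge0 _ _) lB.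
have [c0|c0] := leP 0 (G q - J * B); last first.
  by have := mdist_ge0 q (last q s); nra.
apply: le_trans sB; apply: (@le_trans _ _ ((G q - J * B) * chain_length q s)).
  by rewrite ler_wpM2l// mdist_le_chain_length// mem_last.
apply: chain_length_le_cost => z zs; apply: le_trans (Gg z).
have := GJ q z; have := ler_norm (G q - G z).
have := mdist_le_chain_length zs => h1 h2 h3.
have : J * mdist q z <= J * B by rewrite ler_wpM2l// (le_trans h1).
lra.
Qed.

(** The truncation at M makes the infimum finite where no chain arrives, and makes the
    potential Lipschitz at large scales. *)
Definition potential g (e M : R) (x z : X) : R :=
  inf ([set M] `|` [set chain_cost g x s | s in chains e x z]).

Section potential.
Variables (g : X -> R) (e M J : R) (x : X).
Hypotheses (g0 : forall z, 0 <= g z) (e0 : 0 < e) (M0 : 0 <= M).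
Hypothesis gJ : forall z w, `|g z - g w| <= J * mdist z w.

Let costs z := [set M] `|` [set chain_cost g x s | s in chains e x z].

Let costs_lb z : lbound (costs z) 0.
Proof. by move=> _ [->//|[s _ <-]]; exact: chain_cost_ge0. Qed.

Let costs_has_inf z : has_inf (costs z).
Proof. by split; [exists M; left|exists 0; exact: costs_lb]. Qed.

Lemma potential_ge0 z : 0 <= potential g e M x z.
Proof. by apply: lb_le_inf; [exists M; left|exact: costs_lb]. Qed.

Lemma potential_le_cst z : potential g e M x z <= M.
Proof. by apply: ge_inf; [exists 0; exact: costs_lb|left]. Qed.

Lemma potential_le z s : chains e x z s -> potential g e M x z <= chain_cost g x s.
Proof.
by move=> sz; apply: ge_inf; [exists 0; exact: costs_lb|right; exists s].
Qed.

Lemma potential_origin : potential g e M x x = 0.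
Proof.
apply/eqP; rewrite eq_le potential_ge0 andbT -(chain_cost_nil g x).
exact: potential_le.
Qed.

(** Prolong a chain from x to z by the point w. *)
Lemma potential_step z w : mdist z w <= e ->
  potential g e M x w <= potential g e M x z + step_cost g z w.
Proof.
move=> zw; rewrite -lerBlDr; apply: lb_le_inf; first by exists M; left.
move=> _ [->|[s [sp sl] <-]].
  rewrite lerBlDr (le_trans (potential_le_cst _))// lerDl.
  exact: step_cost_ge0.
rewrite lerBlDr -sl -chain_cost_rcons; apply: potential_le.
split; last by rewrite last_rcons.
by move: sp; rewrite /eps_chain rcons_path => ->; rewrite sl.
Qed.

Lemma potential_chain z (B : R) : B <= M -> potential g e M x z < B ->
  exists2 s, chains e x z s & chain_cost g x s < B.
Proof.
move=> BM /(inf_lt (costs_has_inf z).1)[_ [->|[s sz <-] sB]]; last by exists s.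
by rewrite ltNge BM.
Qed.

Let potential_sub z w : mdist z w <= e ->
  `|potential g e M x w - potential g e M x z| <= step_cost g z w.
Proof.
move=> zw; rewrite ler_norml; have h1 := potential_step zw.
have h2 := @potential_step w z; rewrite metric_sym zw /step_cost in h2.
have {}h2 := h2 isT; rewrite /step_cost (metric_sym w z) in h1 h2 *.
by rewrite addrC in h2; apply/andP; split; lra.
Qed.

(** At distances at most e the bound is that of a single step; at larger distances the
    oscillation is at most M, hence at most M / e times the distance. *)
Lemma Lipschitz_potential (G : R) : (forall z, g z <= G) ->
  Lipschitz (potential g e M x).
Proof.
move=> gG; have G0 : 0 <= G := le_trans (g0 x) (gG x).
exists (G + M / e) => z w; have d0 := mdist_ge0 z w.
have Me : 0 <= M / e by rewrite divr_ge0// ltW.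
have [zw|zw] := leP (mdist z w) e.
  rewrite distrC (le_trans (potential_sub zw))// /step_cost ler_wpM2r//.
  by have := gG z; have := gG w; lra.
apply: (@le_trans _ _ M).
  have := potential_ge0 z; have := potential_ge0 w.
  have := potential_le_cst z; have := potential_le_cst w.
  by move=> *; rewrite ler_norml; apply/andP; split; lra.
rewrite mulrDl (@le_trans _ _ (M / e * mdist z w))//; last first.
  by rewrite lerDr mulr_ge0.
by rewrite mulrAC ler_pdivlMr// ler_wpM2l// ltW.
Qed.

(** The cost of a short step from z is nearly g z times its length, by continuity. *)
Lemma lip_potential z : (lip (potential g e M x) z <= (g z)%:E)%E.
Proof.
apply/lee_addgt0Pr => eta eta0.
have J0 : 0 <= `|J| by [].
pose r := Num.min e (eta / (`|J| + 1)).
have r0 : 0 < r by rewrite lt_min e0 divr_gt0// ltr_wpDl.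
apply: (le_trans (lip_le_slope _ _ r0)).
apply: ge_ereal_sup => _ [->|[w [+ /eqP wz] <-]].
  by rewrite -EFinD lee_fin addr_ge0// ltW.
rewrite ballEmdist/= lt_min => /andP[zwe zwJ].
rewrite -EFinD lee_fin ler_pdivrMr ?mdist_gt0 1?eq_sym//.
rewrite (le_trans (potential_sub (ltW zwe)))// /step_cost ler_wpM2r ?mdist_ge0//.
move: zwJ; rewrite ltr_pdivlMr ?ltr_wpDl// => zwJ.
have := gJ w z; rewrite metric_sym => h; have := ler_norm (g w - g z).
have := mdist_ge0 z w; have := ler_norm J => h1 h2 h3; nra.
Qed.

End potential.

End chain_cost.

(** * Limits of chains of bounded cost *)

Section walk.
Context {R : realType} {X : completeMetricType R}.
Local Open Scope ring_scope.
Variable g : X -> R.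
Hypothesis g1 : forall z, 1 <= g z.
Implicit Types (q z : X) (s : seq X).

Let g0 z : 0 <= g z := le_trans ler01 (g1 z).

(** Parametrizing by the cost, rather than by the length, gives all the chains the same
    interval of times up to a constant end, and turns the bound on the cost into a bound
    on the speed of the motion. *)
Fixpoint walk q s (tau : R) : X :=
  if s is z :: s' then
    if step_cost g q z <= tau then walk z s' (tau - step_cost g q z) else q
  else q.

Lemma walk_cost q s (tau : R) : chain_cost g q s <= tau -> walk q s tau = last q s.
Proof.
elim: s q tau => // z s ih q tau; rewrite chain_cost_cons /= => h.
have := chain_cost_ge0 z s g0 => h0.
by rewrite ifT; [apply: ih|]; lra.
Qed.

Lemma walk0 q s : walk q s 0 = q.
Proof.
elim: s q => // z s ih q /=; case: ifPn => // h.
have qz : q = z.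
  apply: mdist_positivity; apply/eqP; rewrite eq_le mdist_ge0 andbT.
  have := g1 q; have := g1 z; have := mdist_ge0 q z; move: h; rewrite /step_cost.
  by nra.
have -> : step_cost g q z = 0 by rewrite /step_cost qz mdistxx mulr0.
by rewrite subr0 qz.
Qed.

Lemma walk_prefix q s (tau : R) : 0 <= tau ->
  exists s', last q s' = walk q s tau /\ chain_cost g q s' <= tau.
Proof.
elim: s q tau => [|z s ih] q tau tau0 /=.
  by exists [::]; rewrite chain_cost_nil.
case: ifPn => h; last by exists [::]; rewrite chain_cost_nil.
have [|s' [sl sc]] := ih z (tau - step_cost g q z); first by rewrite subr_ge0.
by exists (z :: s'); split => //; rewrite chain_cost_cons; lra.
Qed.

(** The point reached at time t may have been reached up to one step earlier: hence
    the error eta. *)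
Lemma walk_subchain q s (eta t t' : R) : 0 <= eta ->
  path (fun a b => step_cost g a b <= eta) q s ->
  0 <= t -> t <= t' ->
  exists s', last (walk q s t) s' = walk q s t' /\
    chain_cost g (walk q s t) s' <= t' - t + eta.
Proof.
move=> eta0; elim: s q t t' => [|z s ih] q t t' /=.
  move=> _ t0 tt'; exists [::]; rewrite chain_cost_nil; split => //.
  by rewrite addr_ge0// subr_ge0.
move=> /andP[qz zs] t0 tt'; case: ifPn => ht.
  have -> : step_cost g q z <= t' by exact: le_trans tt'.
  have [||s' [h1 h2]] := ih z (t - step_cost g q z) (t' - step_cost g q z) zs.
  - by rewrite subr_ge0.
  - by rewrite lerD2r.
  by exists s'; split => //; lra.
have [s' [sl sc]] := @walk_prefix q (z :: s) t' (le_trans t0 tt').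
exists s'; split => //; apply: (le_trans sc).
by rewrite -ltNge in ht; lra.
Qed.

Lemma walk_in_ball q s (tau B : R) : 0 <= tau -> tau <= B ->
  ball q (B + 1) (walk q s tau).
Proof.
move=> tau0 tauB; have [s' [sl sc]] := walk_prefix q s tau0.
rewrite ballEmdist/= -sl; apply: (@le_lt_trans _ _ B); last by rewrite ltrDl.
apply: le_trans tauB; apply: le_trans sc.
apply: (@le_trans _ _ (1 * chain_length q s')).
  by rewrite mul1r mdist_le_chain_length// mem_last.
by apply: chain_length_le_cost => z _.
Qed.

(** A motion with density g of cost per length has speed at most 1 / g; G is a
    minorant of g, frozen at the starting point. *)
Lemma walk_mdist (G : X -> R) (J : R) q s (eta t t' : R) :
  0 <= J -> 0 <= eta -> (forall z, G z <= g z) ->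
  (forall z w, `|G z - G w| <= J * mdist z w) ->
  path (fun a b => step_cost g a b <= eta) q s ->
  0 <= t -> t <= t' ->
  (G (walk q s t) - J * (t' - t + eta)) * mdist (walk q s t) (walk q s t') <=
  t' - t + eta.
Proof.
move=> J0 eta0 Gg GJ sp t0 tt'.
have [s' [sl sc]] := walk_subchain eta0 sp t0 tt'.
by rewrite -sl; exact: mdist_le_chain_cost.
Qed.

End walk.

Section limit_curve.
Context {R : realType} {X : completeMetricType R}.
Local Open Scope ring_scope.
Variable m : {outer_measure set X -> \bar R}.
Hypotheses (hm : metric_measure_space m) (hD : doubling m).
Variables (g : nat -> X -> R) (c : nat -> seq X) (x y : X) (K : R).
Hypothesis g_ge1 : forall k z, 1 <= g k z.
Hypothesis g_nd : forall j k z, (j <= k)%N -> g j z <= g k z.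
Hypothesis g_Lip : forall k z w, `|g k z - g k w| <= k.+1%:R * mdist z w.
Hypothesis c_end : forall k, last x (c k) = y.
Hypothesis c_cost : forall k, chain_cost (g k) x (c k) <= K.
Hypothesis c_step : forall k,
  path (fun a b => step_cost (g k) a b <= k.+1%:R^-1) x (c k).

(** Pass to the limit at every time along one ultrafilter. The speed bounds with the
    density g j hold for all the chains of index at least j, because the densities
    increase, and survive in the limit, because g j is continuous. *)
Lemma limit_curve : exists f : R -> X, [/\ f 0 = x, f K = y &
  forall t t', 0 <= t -> t <= t' -> t' <= K ->
    mdist (f t) (f t') <= t' - t /\
    forall j, (g j (f t) - j.+1%:R * (t' - t)) * mdist (f t) (f t') <= t' - t].
Proof.
have K0 : 0 <= K.
  apply: le_trans (c_cost 0); apply: chain_cost_ge0 => z.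
  exact: le_trans ler01 (g_ge1 _ _).
have [U [UU oU]] := ultraFilterLemma eventually_filter.
have UF : ProperFilter U by exact: ultra_proper.
have K10 : 0 < K + 1 by rewrite ltr_wpDl.
pose v (t : R) (k : nat) := walk (g k) x (c k) t.
have vlim t : exists w : X, 0 <= t -> t <= K -> v t @ U --> w.
  have [t0|t0] := leP 0 t; last by exists x.
  have [tK|tK] := leP t K; last by exists x.
  have [w vw] := bounded_ultra_cvg hm hD UU K10
    (fun k => walk_in_ball (g_ge1 k) x (c k) t0 tK).
  by exists w.
pose f t := sval (cid (vlim t)).
have fP t : 0 <= t -> t <= K -> v t @ U --> f t by exact: svalP (cid (vlim t)).
have inv_cvg : (k.+1%:R^-1 : R) @[k --> U] --> (0 : R).
  by move=> A /(@cvg_harmonic R) hA; exact: oU.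
have dcvg t t' : 0 <= t -> t <= K -> 0 <= t' -> t' <= K ->
    mdist (v t k) (v t' k) @[k --> U] --> mdist (f t) (f t').
  move=> t0 tK t'0 t'K; apply/cvgrPdist_lt => e e0.
  have e20 : 0 < e / 2 by rewrite divr_gt0.
  have H1 := metricType_numDomainType.cvgr_dist_lt (fP t t0 tK) e20.
  have H2 := metricType_numDomainType.cvgr_dist_lt (fP t' t'0 t'K) e20.
  apply: filterS2 (H1 UF) (H2 UF) => k h1 h2.
  have := metric_triangle (f t) (v t k) (f t').
  have := metric_triangle (v t k) (v t' k) (f t').
  have := metric_triangle (v t k) (f t) (v t' k).
  have := metric_triangle (f t) (f t') (v t' k).
  rewrite (metric_sym (v t k) (f t)) (metric_sym (v t' k) (f t')) => *.
  by rewrite ltr_norml; apply/andP; split; lra.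
exists f; split.
- apply: (@cvg_unique _ (@metric_hausdorff _ X) (v 0 @ U)).
    exact: fP.
  rewrite (_ : v 0 = fun=> x); first exact: cvg_cst.
  by apply/funext => k; rewrite /v walk0.
- apply: (@cvg_unique _ (@metric_hausdorff _ X) (v K @ U)).
    exact: fP.
  rewrite (_ : v K = fun=> y); first exact: cvg_cst.
  by apply/funext => k; rewrite /v walk_cost.
move=> t t' t0 tt' t'K; have tK := le_trans tt' t'K; have t'0 := le_trans t0 tt'.
have rhs : (t' - t + k.+1%:R^-1) @[k --> U] --> t' - t.
  rewrite -[X in _ --> X]addr0; apply: cvgD => //; exact: cvg_cst.
split.
  apply: (ler_cvg_to (dcvg t t' t0 tK t'0 t'K) rhs); apply: nearW => k.
  have := @walk_mdist _ _ _ (g_ge1 k) (cst 1) 0 x (c k) k.+1%:R^-1 t t' (lexx _).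
  rewrite mul0r subr0 mul1r; apply => //.
  by move=> z w; rewrite subrr normr0 mul0r.
move=> j.
have gcvg : g j (v t k) @[k --> U] --> g j (f t).
  have := fP t t0 tK; apply: continuous_cvg.
  by apply: Lipschitz_continuous; exists j.+1%:R; exact: g_Lip.
have lhs : (g j (v t k) - j.+1%:R * (t' - t + k.+1%:R^-1)) * mdist (v t k) (v t' k)
    @[k --> U] --> (g j (f t) - j.+1%:R * (t' - t)) * mdist (f t) (f t').
  apply: cvgM; last exact: dcvg.
  by apply: cvgB => //; apply: cvgM => //; exact: cvg_cst.
apply: (ler_cvg_to lhs rhs); apply: oU; exists j => // k /= jk.
apply: walk_mdist => // z; exact: g_nd.
Qed.

End limit_curve.

(** * Line integrals along the limit curve *)

Section integral_along_limit.
Context {R : realType} {X : completeMetricType R}.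

Lemma Lipschitz_borel_real (u : X -> R) : Lipschitz u -> borel_real u.
Proof.
move=> /Lipschitz_continuous uc; apply/measurable_EFinP.
apply: lsc_measurable => a; apply: open_borel.
rewrite [X in open X](_ : _ = [set z | (a < u z)%R]).
  have := @open_gt R a => /(open_comp (f := u)); apply.
  by move=> z _; exact: uc.
by apply/seteqP; split => z /=; rewrite lte_fin.
Qed.

Lemma Lipschitz_borel (G : X -> R) : Lipschitz G -> (forall z, (0 <= G z)%R) ->
  borel_nonneg (EFin \o G).
Proof.
move=> GL G0; split; first by move=> z; rewrite lee_fin.
by apply/measurable_EFinP; exact: Lipschitz_borel_real.
Qed.

Variables (f : R -> X) (K : R).
Hypotheses (K0 : (0 <= K)%R) (f1 : forall t t', (0 <= t)%R -> (t <= t')%R ->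
  (t' <= K)%R -> (mdist (f t) (f t') <= t' - t)%R).

Lemma curve_1Lipschitz : curve f 0%R K.
Proof.
split => //; apply/subspace_continuousP => t; rewrite /= in_itv/= => /andP[t0 tK].
apply/metricType_numDomainType.cvgrPdist_lt => e e0; rewrite near_withinE.
apply/nbhs_ballP; exists e => // s; rewrite /ball/= in_itv/= => ts /andP[s0 sK].
have [st|/ltW ts'] := leP s t.
  rewrite metric_sym (le_lt_trans (f1 s0 st tK))//.
  by move: ts; rewrite ger0_norm ?subr_ge0.
rewrite (le_lt_trans (f1 t0 ts' sK))//.
by move: ts; rewrite distrC ger0_norm ?subr_ge0.
Qed.

Lemma curve_length_1Lipschitz t t' : (0 <= t)%R -> (t <= t')%R -> (t' <= K)%R ->
  curve_length f t t' <= (t' - t)%:E.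
Proof.
move=> t0 tt' t'K; rewrite -[leRHS]mul1e -EFinM; apply: curve_length_le => //.
move=> s s' ts ss' s't'; rewrite mul1r; apply: f1 => //.
  exact: le_trans ts.
exact: le_trans t'K.
Qed.

Lemma rectifiable_1Lipschitz : rectifiable f 0%R K.
Proof.
by apply: le_lt_trans (curve_length_1Lipschitz _ _ _) (ltry _).
Qed.

(** The hypothesis fG bounds the speed of f by 1 / G; integrating it over short
    arcs, on which the Lipschitz function G is nearly constant, bounds the
    integral of G by the duration. *)
Lemma curve_integral_le_duration (G : X -> R) (J : R) : (0 <= J)%R ->
  (forall z, (0 <= G z)%R) ->
  (forall z w, (`|G z - G w| <= J * mdist z w)%R) ->
  (forall t t', (0 <= t)%R -> (t <= t')%R -> (t' <= K)%R ->
    ((G (f t) - J * (t' - t)) * mdist (f t) (f t') <= t' - t)%R) ->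
  curve_integral (EFin \o G) f 0%R K <= K%:E.
Proof.
move=> J0 G0 GJ fG.
have fc := curve_1Lipschitz; have fr := rectifiable_1Lipschitz.
pose P := arc_length_param f 0%R K; pose l := arc_length f 0%R.
have Gb : borel_nonneg (EFin \o G) by apply: Lipschitz_borel => //; exists J.
have mGP : measurable_fun `[0%R, l K] ((EFin \o G) \o P).
  exact: (measurable_arc_length_param fc fr Gb.2).
pose prim s := \int[lebesgue_measure]_(tau in `[0%R, s]) (G (P tau))%:E.
have step t t' : (0 <= t)%R -> (t <= t')%R -> (t' <= K)%R ->
    prim (l t') <= prim (l t) + (t' - t + 2 * J * (t' - t) ^+ 2)%:E.
  move=> t0 tt' t'K; have tK := le_trans tt' t'K; have t'0 := le_trans t0 tt'.
  have lt0 : (0 <= l t)%R by rewrite -(arc_length_a fc fr) (arc_length_nd fr).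
  have ltt' : (l t <= l t')%R by rewrite (arc_length_nd fr).
  have lt'K : (l t' <= l K)%R by rewrite (arc_length_nd fr).
  have ll : (l t' - l t <= t' - t)%R.
    rewrite -lee_fin (arc_lengthB fr)//; exact: curve_length_1Lipschitz.
  rewrite /prim (ge0_integral_itv_split lt0 ltt' lt'K mGP); last first.
    by move=> r; rewrite lee_fin.
  apply: leeD => //; set D := (t' - t)%R in ll *.
  have D0 : (0 <= D)%R by rewrite subr_ge0.
  have JD : (0 <= J * D)%R by rewrite mulr_ge0.
  apply: (@le_trans _ _ (\int[lebesgue_measure]_(tau in `]l t, l t'])
      (G (f t) + J * D)%:E)).
    apply: ge0_le_integral => //.
    - by move=> r _; rewrite lee_fin.
    - apply: measurable_funS mGP => //.
      by apply: subset_itv; rewrite bnd_simp.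
    - move=> r; rewrite /= in_itv/= => /andP[ltr rlt'].
      rewrite lee_fin -(arc_length_paramE fc fr t0 tK) -/P -/(l t).
      have := mdist_arc_length_param fc fr lt0 (ltW ltr) (le_trans rlt' lt'K).
      rewrite -/P => dP; have := GJ (P r) (P (l t)); rewrite metric_sym => h.
      have := ler_norm (G (P r) - G (P (l t)))%R => h'.
      have : (J * mdist (P (l t)) (P r) <= J * D)%R by rewrite ler_wpM2l//; lra.
      by lra.
  rewrite integral_cst//= lebesgue_measure_itv/= lte_fin.
  case: ifPn => [_|_]; last first.
    by rewrite mule0 lee_fin addr_ge0// !mulr_ge0// exprn_ge0.
  rewrite -EFinB -EFinM lee_fin.
  have lB0 : (0 <= l t' - l t)%R by rewrite subr_ge0.
  have key : ((G (f t) - J * D) * (l t' - l t) <= D)%R.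
    have [c0|c0] := leP (G (f t) - J * D)%R 0%R; first by nra.
    rewrite mulrC -ler_pdivlMr// mulrC -lee_fin (arc_lengthB fr)//.
    apply: curve_length_le => // s s' ts ss' s't'.
    rewrite mulrC ler_pdivlMr// mulrC.
    apply: le_trans (fG _ _ (le_trans t0 ts) ss' (le_trans s't' t'K)).
    rewrite ler_wpM2r ?mdist_ge0//.
    have := GJ (f t) (f s); have := ler_norm (G (f t) - G (f s))%R.
    have := f1 t0 ts (le_trans ss' (le_trans s't' t'K)) => h1 h2 h3.
    have : (J * mdist (f t) (f s) <= J * (s - t))%R by rewrite ler_wpM2l.
    have : (J * (s' - t) <= J * D)%R by rewrite ler_wpM2l// lerD2r.
    by lra.
  have : (J * D * (l t' - l t) <= J * D * D)%R by rewrite ler_wpM2l.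
  rewrite expr2; lra.
have -> : curve_integral (EFin \o G) f 0%R K = prim (l K) by [].
apply/lee_addgt0Pr => eta eta0.
(* with n.+1 arcs the quadratic errors of the steps add up to at most eta *)
have [n nP] : exists n : nat, (2 * J * K ^+ 2 <= eta * n.+1%:R)%R.
  exists (Num.truncn (2 * J * K ^+ 2 / eta)%R).
  have := Num.Theory.truncnS_gt (2 * J * K ^+ 2 / eta)%R.
  by rewrite ltr_pdivrMr//; lra.
pose h := (K / n.+1%:R)%R.
have h0 : (0 <= h)%R by rewrite divr_ge0.
have hK : (h *+ n.+1 = K)%R by rewrite -mulr_natr divfK// pnatr_eq0.
have ind k : (k <= n.+1)%N -> prim (l (h *+ k)%R) <= ((h + 2 * J * h ^+ 2) *+ k)%:E.
  elim: k => [_|k ih kn].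
    by rewrite !mulr0n /l (arc_length_a fc fr) /prim set_itv1 integral_set1.
  have hE : (h *+ k.+1 - h *+ k = h)%R by rewrite mulrSr addrAC subrr add0r.
  apply: (le_trans (step (h *+ k)%R (h *+ k.+1)%R _ _ _)).
  - by rewrite mulrn_wge0.
  - by rewrite -subr_ge0 hE.
  - by rewrite -hK ler_wpMn2l.
  - by rewrite hE [in leRHS]mulrSr [leRHS]EFinD leeD2r// ih// ltnW.
have := ind n.+1 (leqnn _); rewrite hK => /le_trans; apply.
rewrite -EFinD lee_fin mulrnDl hK lerD2l -[(_ *+ n.+1)%R]mulr_natr.
have n0 : (0 < n.+1%:R :> R)%R by rewrite ltr0n.
have -> : (2 * J * h ^+ 2 * n.+1%:R = 2 * J * K ^+ 2 / n.+1%:R)%R.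
  by rewrite /h expr_div_n; field; rewrite gt_eqF.
by rewrite ler_pdivrMr.
Qed.

End integral_along_limit.

(** * Lipschitz approximation of lower semicontinuous functions *)

Section lipschitz_approximation.
Context {R : realType} {X : completeMetricType R}.
Variable h : X -> \bar R.
Hypotheses (h1 : forall z, 1 <= h z) (ho : forall a : R, open [set z | a%:E < h z]).

Let trunc (k : nat) z : R := fine (mine (h z) k.+1%:R%:E).

Let truncE k z : (trunc k z)%:E = mine (h z) k.+1%:R%:E.
Proof.
rewrite fineK// ge0_fin_numE; last first.
  by rewrite le_min (le_trans _ (h1 z))//= lee_fin.
by rewrite gt_min ltry orbT.
Qed.

Let trunc_ge1 k z : (1 <= trunc k z)%R.
Proof. by rewrite -lee_fin truncE le_min h1 lee_fin ler1n. Qed.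

Let trunc_le k z : (trunc k z <= k.+1%:R)%R.
Proof. by rewrite -lee_fin truncE ge_min lexx orbT. Qed.

(** The inf-convolution of the truncated function with a cone: the largest function
    below it that is Lipschitz with constant k + 1. *)
Definition lip_approx (k : nat) z : R :=
  inf [set (trunc k w + k.+1%:R * mdist z w)%R | w in [set: X]].

Let values k z := [set (trunc k w + k.+1%:R * mdist z w)%R | w in [set: X]].

Let values_lb k z : lbound (values k z) 1%R.
Proof.
move=> _ [w _ <-]; apply: (le_trans (trunc_ge1 k w)).
by rewrite lerDl mulr_ge0// mdist_ge0.
Qed.

Let values_neq0 k z : values k z !=set0.
Proof. by exists (trunc k z + k.+1%:R * mdist z z)%R; exists z. Qed.

Let approx_le k z w :
  (lip_approx k z <= trunc k w + k.+1%:R * mdist z w)%R.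
Proof. by apply: ge_inf; [exists 1%R; exact: values_lb|exists w]. Qed.

Let le_approx k z (a : R) :
  (forall w, a <= trunc k w + k.+1%:R * mdist z w)%R -> (a <= lip_approx k z)%R.
Proof. by move=> H; apply: lb_le_inf => [|_ [w _ <-]]; [exact: values_neq0|exact: H]. Qed.

Lemma lip_approx_ge1 k z : (1 <= lip_approx k z)%R.
Proof. by apply: lb_le_inf; [exact: values_neq0|exact: values_lb]. Qed.

Let approx_le_trunc k z : (lip_approx k z <= trunc k z)%R.
Proof. by apply: le_trans (approx_le k z z) _; rewrite mdistxx mulr0 addr0. Qed.

Lemma lip_approx_le k z : (lip_approx k z <= k.+1%:R)%R.
Proof. exact: le_trans (approx_le_trunc _ _) (trunc_le _ _). Qed.

Lemma lip_approx_le_fun k z : (lip_approx k z)%:E <= h z.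
Proof.
apply: (@le_trans _ _ (trunc k z)%:E); first by rewrite lee_fin approx_le_trunc.
by rewrite truncE ge_min lexx.
Qed.

Lemma lip_approx_nd j k z : (j <= k)%N -> (lip_approx j z <= lip_approx k z)%R.
Proof.
move=> jk; apply: le_approx => w; apply: (le_trans (approx_le j z w)).
have jkR : (j.+1%:R <= k.+1%:R :> R)%R by rewrite ler_nat ltnS.
apply: lerD; last by rewrite ler_wpM2r// mdist_ge0.
rewrite -lee_fin !truncE le_min ge_min lexx/= ge_min; apply/orP; right.
by rewrite lee_fin.
Qed.

Lemma lip_approx_Lipschitz k z w :
  (`|lip_approx k z - lip_approx k w| <= k.+1%:R * mdist z w)%R.
Proof.
suff H z' w' : (lip_approx k z' <= lip_approx k w' + k.+1%:R * mdist z' w')%R.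
  have h1' := H z w; have h2' := H w z; rewrite (metric_sym w) in h2'.
  by rewrite ler_norml; apply/andP; split; lra.
rewrite -lerBlDr; apply: le_approx => q; rewrite lerBlDr.
apply: (le_trans (approx_le k z' q)); rewrite -addrA lerD2l -mulrDr ler_wpM2l//.
by rewrite addrC metric_triangle.
Qed.

(** If b < h z, then b < h on a ball around z; outside this ball the cone exceeds b
    as soon as k is large. *)
Lemma cvg_lip_approx z : (lip_approx k z)%:E @[k --> \oo] --> h z.
Proof.
have nd : nondecreasing_seq (fun k => (lip_approx k z)%:E).
  by move=> j k jk; rewrite lee_fin lip_approx_nd.
rewrite (_ : h z = ereal_sup (range (fun k => (lip_approx k z)%:E))).
  exact: ereal_nondecreasing_cvgn.
apply/eqP; rewrite eq_le; apply/andP; split; last first.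
  by apply: ge_ereal_sup => _ [k _ <-]; exact: lip_approx_le_fun.
rewrite leNgt; apply/negP => lth.
have ge_sup k : (lip_approx k z)%:E <= ereal_sup (range (fun k => (lip_approx k z)%:E)).
  by apply: ereal_sup_ubound; exists k.
set S := ereal_sup _ in lth ge_sup.
have [a Sa] : exists a : R, S = a%:E.
  have := le_trans (lee_tofin (lip_approx_ge1 0%N z)) (ge_sup 0%N).
  case: S lth {ge_sup} => [a _ _|+ _|_]; first by exists a.
    by rewrite ltNge leey.
  by rewrite leeNy_eq.
rewrite Sa in lth ge_sup.
have [b ab bh] : exists2 b : R, (a < b)%R & b%:E < h z.
  move: lth; case: (h z) => [r||//]; last by exists (a + 1)%R; rewrite ?ltry ?ltrDl.
  by rewrite lte_fin => ar; exists ((a + r) / 2)%R; rewrite ?lte_fin; lra.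
have /nbhs_ballP[r /= r0 rb] : nbhs z [set w | b%:E < h w].
  exact: open_nbhs_nbhs.
have [k bk brk] : exists2 k, (b <= k.+1%:R)%R & (b <= k.+1%:R * r)%R.
  have b0 : (0 <= b)%R.
    apply: le_trans (ltW ab); apply: (le_trans ler01).
    by rewrite -lee_fin (le_trans _ (ge_sup 0%N))// lee_fin lip_approx_ge1.
  exists (Num.truncn b + Num.truncn (b / r)%R)%N.
    apply: (le_trans (ltW (Num.Theory.truncnS_gt _))).
    by rewrite ler_nat ltnS leq_addr.
  rewrite -ler_pdivrMr//; apply: (le_trans (ltW (Num.Theory.truncnS_gt _))).
  by rewrite ler_nat ltnS leq_addl.
have := ge_sup k; rewrite lee_fin leNgt => /negP; apply.
apply: (lt_le_trans ab); apply: le_approx => w.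
have [zw|zw] := ltP (mdist z w) r.
  apply: (@le_trans _ _ (trunc k w)).
    rewrite -lee_fin truncE le_min lee_fin bk andbT ltW//.
    by apply: rb; rewrite ballEmdist.
  by rewrite lerDl mulr_ge0// mdist_ge0.
apply: (le_trans brk); apply: (@le_trans _ _ (k.+1%:R * mdist z w)%R).
  by rewrite ler_wpM2l.
by rewrite lerDr (le_trans ler01).
Qed.

End lipschitz_approximation.

(** * Outer regularity of finite Borel measures *)

Section borel_measures.
Context {R : realType} {X : completeMetricType R}.
Variable m : {outer_measure set X -> \bar R}.
Hypothesis hm : metric_measure_space m.
Variable nu : {measure set (caratheodory_type m) -> \bar R}.
Hypothesis nufin : nu setT < +oo.

Lemma measurable_fun_cara (g : X -> \bar R) :
  measurable_fun setT (g : g_sigma_algebraType (@open X) -> \bar R) ->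
  measurable_fun setT (g : caratheodory_type m -> \bar R).
Proof.
move=> mg _ B mB; rewrite setTI; apply: (measurable_cara hm).
by rewrite -[_ @^-1` _]setTI; exact: mg.
Qed.

Lemma open_cara (U : set X) : open U -> measurable (U : set (caratheodory_type m)).
Proof. by move=> oU; apply: (measurable_cara hm); exact: open_borel. Qed.

Let nu_fin (A : set (caratheodory_type m)) : measurable A -> nu A < +oo.
Proof.
by move=> mA; apply: le_lt_trans nufin; apply: le_measure; rewrite ?inE.
Qed.

(** Both the set and its complement are approximated from outside, with a small
    overlap: this form of regularity is symmetric under complements. *)
Let regular (A : set X) := forall e : R, (0 < e)%R ->
  exists U Q : set X, [/\ open U, open Q, A `<=` U, ~` A `<=` Q &
    nu (U `&` Q : set (caratheodory_type m)) <= e%:E].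

(** The neighbourhoods of the closed complement shrink to it, so that their traces on A
    decrease to the empty set. *)
Let regular_open (A : set X) : open A -> regular A.
Proof.
move=> oA e e0.
pose Q (n : nat) : set X := \bigcup_(w in ~` A) ball w n.+1%:R^-1.
have oQ n : open (Q n) by apply: bigcup_open => w _; exact: ball_open_metric.
have AQ n : measurable (A `&` Q n : set (caratheodory_type m)).
  by apply: open_cara; exact: openI.
have cap0 : \bigcap_n (A `&` Q n) = set0.
  rewrite -subset0 => z zO; have [Az _] := zO 0%N I.
  have /nbhs_ballP[r /= r0 rA] : nbhs z A by exact: open_nbhs_nbhs.
  have [_ [w Aw]] := zO (Num.truncn r^-1) I.
  rewrite ballEmdist/= => wz; apply: Aw; apply: rA.
  rewrite ballEmdist/= metric_sym (lt_le_trans wz)// invf_ple ?posrE//.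
  exact/ltW/Num.Theory.truncnS_gt.
have := @nonincreasing_cvg_mu _ (caratheodory_type m) R nu
  (fun n => A `&` Q n) (nu_fin (AQ 0%N)) AQ.
rewrite cap0 measure0 => /(_ measurable0) H.
have [n nue] : exists n, nu (A `&` Q n : set (caratheodory_type m)) < e%:E.
  have {}H : nu \o (fun n => A `&` Q n) @ \oo --> 0.
    apply: H => i j ij; apply/subsetPset => z [Az [w Aw wz]]; split => //.
    exists w => //; move: wz; rewrite !ballEmdist/= => /lt_le_trans; apply.
    by rewrite lef_pV2 ?posrE// ler_nat ltnS.
  have : \forall n \near \oo, (nu \o (fun n => A `&` Q n)) n < e%:E.
    by apply: (H _ (open_ereal_lt' _)); rewrite lte_fin.
  by move=> [n _ /(_ n (leqnn n))]; exists n.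
exists A, (Q n); split => //; last exact: ltW.
by move=> w Aw; exists w => //; apply: ballxx; rewrite invr_gt0.
Qed.

Let regularC (A : set X) : regular A -> regular (~` A).
Proof.
move=> rA e e0; have [U [Q [oU oQ AU AQ UQ]]] := rA e e0.
by exists Q, U; split; rewrite ?setCK// setIC.
Qed.

(** The complement of the union is approximated by finite intersections, up to a set of
    small measure, since an infinite intersection need not be open. *)
Let regular_bigcup (A : (set X)^nat) : (forall n, regular (A n)) ->
  regular (\bigcup_n A n).
Proof.
move=> rA e e0; have e20 : (0 < e / 2)%R by rewrite divr_gt0.
have en n : (0 < e / 2 / (2 ^ n.+1)%:R)%R by rewrite divr_gt0// ltr0n expn_gt0.
have rA1 n := rA n _ (en n).
pose U n := sval (cid (rA1 n)).
have rA2 n : exists Q : set X, [/\ open (U n), open Q, A n `<=` U n, ~` A n `<=` Q &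
    nu (U n `&` Q : set (caratheodory_type m)) <= (e / 2 / (2 ^ n.+1)%:R)%:E].
  exact: svalP (cid (rA1 n)).
pose Q n := sval (cid (rA2 n)).
have {}rA n : [/\ open (U n), open (Q n), A n `<=` U n, ~` A n `<=` Q n &
    nu (U n `&` Q n : set (caratheodory_type m)) <= (e / 2 / (2 ^ n.+1)%:R)%:E].
  exact: svalP (cid (rA2 n)).
pose W := \bigcup_n U n; pose V n := \bigcap_(i < n.+1) Q i.
have oW : open W by apply: bigcup_open => n _; case: (rA n).
have oV n : open (V n).
  rewrite /V bigcap_mkord; elim/big_ind : _ => //; first exact: openT.
    by move=> ? ? ? ?; exact: openI.
  by move=> i _; case: (rA i).
have mWV n : measurable (W `&` V n : set (caratheodory_type m)).
  by apply: open_cara; exact: openI.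
have mUQ n : measurable (U n `&` Q n : set (caratheodory_type m)).
  by apply: open_cara; case: (rA n) => ? ? _ _ _; exact: openI.
have mcap : measurable (\bigcap_n (W `&` V n) : set (caratheodory_type m)).
  exact: bigcapT_measurable.
have nu_cap : nu (\bigcap_n (W `&` V n) : set (caratheodory_type m)) <= (e / 2)%:E.
  apply: (@le_trans _ _ (\sum_(n <oo) nu (U n `&` Q n : set (caratheodory_type m)))).
    apply: measure_sigma_subadditive => // z zV.
    have [[n _ Unz] _] := zV 0%N I; exists n => //; split => //.
    by have [_] := zV n I; apply => /=.
  apply: le_trans (epsilon_trick0 xpredT (ltW e20)).
  by apply: lee_nneseries => // n _; case: (rA n).
have [n nP] : exists n, nu (W `&` V n : set (caratheodory_type m)) < e%:E.
  have ni : nonincreasing_seq (fun n => W `&` V n).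
    move=> i j ij; apply/subsetPset => z [Wz Vz]; split => // k /= ki.
    by apply: Vz => /=; exact: leq_trans ki _.
  have H := @nonincreasing_cvg_mu _ (caratheodory_type m) R nu
    (fun n => W `&` V n) (nu_fin (mWV 0%N)) mWV mcap ni.
  have : \forall n \near \oo, (nu \o (fun n => W `&` V n)) n < e%:E.
    apply: (H _ (open_ereal_lt' _)); apply: (le_lt_trans nu_cap).
    by rewrite lte_fin; lra.
  by move=> [n _ /(_ n (leqnn n))]; exists n.
exists W, (V n); split => //.
- by move=> z [k _ Akz]; exists k => //; case: (rA k) => _ _ + _ _; apply.
- move=> z Az k _; case: (rA k) => _ _ _ + _; apply => Akz.
  by apply: Az; exists k.
- exact: ltW.
Qed.

Lemma borel_outer_regular (A : set X) (e : R) :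
  measurable (A : set (g_sigma_algebraType (@open X))) -> (0 < e)%R ->
  exists U : set X, [/\ open U, A `<=` U &
    nu (U : set (caratheodory_type m)) <=
    nu (A : set (caratheodory_type m)) + e%:E].
Proof.
move=> mA e0; have rA : regular A.
  suff : <<s @open X >> `<=` regular by apply.
  apply: smallest_sub.
    split; [|by move=> B; rewrite setTD; exact: regularC|exact: regular_bigcup].
    by apply: regular_open; exact: open0.
  exact: regular_open.
have [U [Q [oU oQ AU AQ UQ]]] := rA e e0.
have mA' := measurable_cara hm mA.
exists U; split => //.
have UE : U = A `|` (U `\` A) by rewrite setDUK.
rewrite [in leLHS]UE.
apply: (le_trans (measureU2 _ _ _)) => //.
  by apply: measurableD => //; exact: open_cara.
apply: leeD => //; apply: le_trans UQ; apply: le_measure; rewrite ?inE.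
- by apply: measurableD => //; exact: open_cara.
- by apply: open_cara; exact: openI.
- by move=> z [Uz /AQ].
Qed.

End borel_measures.

(** * Lower semicontinuous majorants *)

Section vitali_caratheodory.
Context {R : realType} {X : completeMetricType R}.
Variable m : {outer_measure set X -> \bar R}.
Hypothesis hm : metric_measure_space m.
Variable nu : {measure set (caratheodory_type m) -> \bar R}.
Hypothesis nufin : nu setT < +oo.

(** The number of integers n >= 0 below f z is at most f z + 1. *)
Lemma nneseries_levels_le (f : X -> \bar R) z : 0 <= f z ->
  \sum_(n <oo) (\1_[set w : X | (n%:R%:E < f w)%E] z : R)%:E <= f z + 1.
Proof.
move=> f0; apply: lime_le.
  by apply: is_cvg_nneseries => n _ _; rewrite lee_fin.
apply: nearW => N.
suff : \sum_(0 <= n < N) (\1_[set w : X | (n%:R%:E < f w)%E] z : R)%:E <= f z + 1 /\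
    \sum_(0 <= n < N) (\1_[set w : X | (n%:R%:E < f w)%E] z : R)%:E <= N%:R%:E.
  by case.
elim: N => [|N [ih1 ih2]]; first by rewrite big_geq//; split; rewrite ?adde_ge0.
rewrite big_nat_recr//= indicE.
case: (boolP (z \in _)) => [|_]; last first.
  by rewrite adde0; split => //; rewrite (le_trans ih2)// lee_fin ler_nat.
rewrite inE/= => Nf; split; first by rewrite leeD2r// (le_trans ih2)// ltW.
by rewrite (_ : N.+1%:R%:E = N%:R%:E + 1) ?leeD2r// -EFinD natr1.
Qed.

(** Cover each superlevel set of the p-th power of g by an open set that is only
    slightly larger, and let h jump upwards on these sets, through the p-th roots of
    the integers. In contrast to the Vitali-Caratheodory theorem the integral of the
    p-th power grows by a fixed amount; H is a measurable majorant of this power. *)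
Lemma lsc_majorant (p : R) (g : X -> \bar R) : (0 < p)%R -> borel_nonneg g ->
  exists h H : X -> \bar R,
  [/\ forall z, 1 <= h z, forall a : R, open [set z | a%:E < h z],
      forall z, g z <= h z &
   [/\ measurable_fun setT (H : caratheodory_type m -> \bar R),
      forall z, 0 <= H z,
      forall z (a : R), (0 <= a)%R -> a%:E <= h z -> (a `^ p)%:E <= H z &
      \int[nu]_z H z <= \int[nu]_z (g z `^ p) + (2 * fine (nu setT) + 1)%:E]].
Proof.
move=> p0 [g0 mg]; pose f z := g z `^ p.
have mf : measurable_fun setT (f : g_sigma_algebraType (@open X) -> \bar R).
  exact: (measurableT_comp (measurable_poweR _) mg).
have f0 z : 0 <= f z by exact: poweR_ge0.
pose E (n : nat) := [set z | n%:R%:E < f z].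
have mE n : measurable (E n : set (g_sigma_algebraType (@open X))).
  by rewrite -[E n]setTI; exact: emeasurable_fun_o_infty.
have en n : (0 < 1 / (2 ^ n.+1)%:R :> R)%R by rewrite divr_gt0// ltr0n expn_gt0.
have UP0 n := borel_outer_regular hm nufin (mE n) (en n).
pose U n := sval (cid (UP0 n)).
have UP n : [/\ open (U n), E n `<=` U n & nu (U n : set (caratheodory_type m)) <=
    nu (E n : set (caratheodory_type m)) + (1 / (2 ^ n.+1)%:R)%:E].
  exact: svalP (cid (UP0 n)).
pose V n := \bigcap_(i < n.+1) U i.
have oV n : open (V n).
  rewrite /V bigcap_mkord; elim/big_ind : _ => //; first exact: openT.
    by move=> ? ? ? ?; exact: openI.
  by move=> i _; case: (UP i).
have VS i n : (i <= n)%N -> V n `<=` V i.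
  by move=> ij z Vz k /= ki; apply: Vz => /=; exact: leq_trans ki _.
have mV n : measurable (V n : set (caratheodory_type m)) by exact: (open_cara hm).
have mEc n : measurable (E n : set (caratheodory_type m)).
  exact: (measurable_cara hm).
pose h z := ereal_sup (1 |` [set (n.+1%:R `^ p^-1)%:E | n in [set n | V n z]]).
pose H z := 1 + \sum_(n <oo) (\1_(V n) z : R)%:E.
have h1 z : 1 <= h z by apply: ereal_sup_ubound; left.
exists h, H; split => //.
- move=> a; rewrite [X in open X](_ : _ = [set z | (a < 1)%R] `|`
      \bigcup_(n in [set n : nat | (a < n.+1%:R `^ p^-1)%R]) V n).
    apply: openU; last by apply: bigcup_open => n _; exact: oV.
    have [a1|a1] := ltP a 1%R.
      by rewrite [X in open X](_ : _ = setT); [exact: openT|by apply/seteqP; split].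
    by rewrite [X in open X](_ : _ = set0); [exact: open0|by apply/seteqP; split].
  apply/seteqP; split => z /=.
    move=> /ereal_sup_gt[_ [->|[n Vn <-]]]; rewrite lte_fin => a1; first by left.
    by right; exists n.
  move=> [a1|[n a1 Vn]]; first by rewrite (lt_le_trans _ (h1 z))// lte_fin.
  apply: (@lt_le_trans _ _ (n.+1%:R `^ p^-1)%:E); first by rewrite lte_fin.
  by apply: ereal_sup_ubound; right; exists n.
- move=> z; rewrite leNgt; apply/negP => hg.
  have [r r1 hr] : exists2 r : R, (1 <= r)%R & h z = r%:E.
    move: (h1 z) hg; case: (h z) => [r r1 _|_|]; first by exists r.
      by rewrite ltNge leey.
    by rewrite leeNy_eq.
  have r0 : (0 <= r)%R by exact: le_trans r1.
  have rf : (r `^ p)%:E < f z.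
    move: hg; rewrite hr /f; case: (g z) (g0 z) => [s s0||//].
      by rewrite poweR_EFin !lte_fin => rs; apply: gt0_ltr_powR; rewrite ?nnegrE.
    by move=> _ _; rewrite poweRyr ?ltry// gt_eqF.
  pose n := Num.truncn (r `^ p).
  have Vn : V n z.
    move=> k /= kn; case: (UP k) => _ + _; apply.
    rewrite /E/=; apply: le_lt_trans rf; rewrite lee_fin.
    by rewrite -(Num.Theory.truncn_ge_nat k (powR_ge0 _ _)).
  have : (n.+1%:R `^ p^-1)%:E <= h z.
    by apply: ereal_sup_ubound; right; exists n.
  rewrite hr lee_fin leNgt => /negP; apply.
  have -> : r = ((r `^ p) `^ p^-1)%R by rewrite -powRrM mulfV ?gt_eqF// powRr1.
  apply: gt0_ltr_powR; rewrite ?invr_gt0 ?nnegrE ?powR_ge0//.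
  exact: Num.Theory.truncnS_gt.
have indic0 n z : 0 <= (\1_(V n) z : R)%:E by rewrite lee_fin.
have mindic n : measurable_fun setT
    ((fun z => (\1_(V n) z)%:E) : caratheodory_type m -> \bar R).
  exact/measurable_EFinP/measurable_indic.
have mS : measurable_fun setT
    ((fun z => \sum_(n <oo) (\1_(V n) z : R)%:E) : caratheodory_type m -> \bar R).
  exact: ge0_emeasurable_sum.
have S0 z : 0 <= \sum_(n <oo) (\1_(V n) z : R)%:E by exact: nneseries_ge0.
split.
- exact: emeasurable_funD.
- by move=> z; rewrite adde_ge0.
- move=> z a a0 ah; have [Hy|Hy] := leP +oo (H z); first exact: le_trans (leey _) Hy.
  have H1 : 1 <= H z by rewrite leeDl.
  have [r rE] : exists r : R, H z = r%:E.
    by case: (H z) Hy H1 => // r _ _; exists r.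
  rewrite rE lee_fin in H1 *.
  have r0 : (0 <= r)%R by exact: le_trans H1.
  suff hr : h z <= (r `^ p^-1)%:E.
    have := le_trans ah hr; rewrite lee_fin => ar.
    have -> : r = ((r `^ p^-1) `^ p)%R by rewrite -powRrM mulVf ?gt_eqF// powRr1.
    by apply: ge0_ler_powR; rewrite ?nnegrE ?powR_ge0 ?(ltW p0).
  apply: ge_ereal_sup => _ [->|[n Vn <-]]; rewrite lee_fin.
    rewrite -[leLHS](_ : (1 `^ p^-1)%R = 1%R); last by rewrite powR1.
    by apply: ge0_ler_powR; rewrite ?nnegrE ?invr_ge0 ?(ltW p0).
  apply: ge0_ler_powR; rewrite ?nnegrE ?invr_ge0 ?(ltW p0)//.
  rewrite -lee_fin -rE -[n.+1]add1n natrD EFinD leeD2l//.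
  apply: le_trans (nneseries_lim_ge n _) => //.
  rewrite (eq_big_nat _ _ (F2 := fun=> 1)); last first.
    move=> i /andP[_ ni]; rewrite indicE mem_set//.
    by apply: (VS i n _ z Vn); exact: ltnW.
  by rewrite sumEFin lee_fin sumr_const_nat subn0.
rewrite ge0_integralD//.
rewrite integral_cst// mul1e integral_nneseries//.
under eq_eseriesr do rewrite integral_indic// setIT.
have nuT : nu setT \is a fin_num by rewrite ge0_fin_numE.
have step1 : \sum_(n <oo) nu (V n : set (caratheodory_type m)) <=
    \sum_(n <oo) nu (E n : set (caratheodory_type m)) + 1.
  apply: le_trans (epsilon_trick xpredT _ ler01) => //.
  apply: lee_nneseries => // n _; case: (UP n) => _ _; apply: le_trans.
  apply: le_measure; rewrite ?inE//; first by apply: (open_cara hm); case: (UP n).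
  by move=> z; apply => /=.
have step2 : \sum_(n <oo) nu (E n : set (caratheodory_type m)) <=
    \int[nu]_z f z + nu setT.
  have mfc := measurable_fun_cara hm mf.
  have -> : nu setT = \int[nu]_(z in setT) 1 by rewrite integral_cst// mul1e.
  rewrite -ge0_integralD//.
  rewrite (eq_eseriesr (g := fun n => \int[nu]_z (\1_(E n) z : R)%:E)); last first.
    by move=> n _; rewrite integral_indic// setIT.
  have mindE n : measurable_fun setT
      ((fun z => (\1_(E n) z)%:E) : caratheodory_type m -> \bar R).
    exact/measurable_EFinP/measurable_indic.
  rewrite -integral_nneseries//.
  apply: ge0_le_integral => //.
  - by move=> z _; apply: nneseries_ge0 => n _ _; rewrite lee_fin.
  - by apply: ge0_emeasurable_sum => // n z _ _; rewrite lee_fin.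
  - exact: emeasurable_funD.
  - by move=> z _; exact: nneseries_levels_le.
apply: (@le_trans _ _ (nu setT + (\int[nu]_z f z + nu setT + 1))).
  by apply: leeD => //; apply: (le_trans step1); exact: leeD.
have K (a b : \bar R) : a + (b + a + 1) = b + (a + (a + 1)).
  by rewrite -[b + a + 1]addeA [LHS]addeCA.
rewrite K; apply: leeD; first exact: lexx.
case: (nu setT) nuT => // r _; rewrite -[fine r%:E]/r -!EFinD lee_fin; lra.
Qed.

End vitali_caratheodory.

(** * From the inequality for Lipschitz functions to short curves *)

Section poincare_curves.
Context {R : realType} {X : completeMetricType R}.
Variable m : {outer_measure set X -> \bar R}.
Hypotheses (hm : metric_measure_space m) (hD : doubling m).
Variable nu : {measure set (caratheodory_type m) -> \bar R}.
Hypothesis nufin : nu setT < +oo.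
Variable p : R.
Hypothesis p1 : (1 <= p)%R.

Let p0 : (0 < p)%R. Proof. exact: lt_le_trans p1. Qed.

Lemma measurable_fun_cara_pow (g : X -> \bar R) :
  measurable_fun setT (g : g_sigma_algebraType (@open X) -> \bar R) ->
  measurable_fun setT ((fun z => g z `^ p) : caratheodory_type m -> \bar R).
Proof.
move=> mg; apply: (measurable_fun_cara hm).
exact: (measurableT_comp (measurable_poweR _) mg).
Qed.

Lemma measurable_lip (u : X -> R) : Lipschitz u ->
  measurable_fun setT (lip u : g_sigma_algebraType (@open X) -> \bar R).
Proof.
move=> uL.
have ms (n : nat) : measurable_fun setT
    (slope n.+1%:R^-1 u : g_sigma_algebraType (@open X) -> \bar R).
  by case: (borel_nonneg_slope n.+1%:R^-1 (Lipschitz_continuous uL)).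
by apply: (emeasurable_fun_cvg _ _ ms) => z _; exact: cvg_slope_lip.
Qed.

(** The powers decrease with n; a limit L above the power of lip u z would put the
    p-th root of L above lip u z, hence above some slope. *)
Lemma cvg_slope_lip_pow (u : X -> R) z :
  (slope n.+1%:R^-1 u z) `^ p @[n --> \oo] --> lip u z `^ p.
Proof.
have slope_mono i j : (i <= j)%N -> slope j.+1%:R^-1 u z <= slope i.+1%:R^-1 u z.
  by move=> ij; apply: slope_nd; rewrite lef_pV2 ?posrE// ler_nat ltnS.
have pow_mono : {in `[0, +oo] &, {homo (@poweR R)^~ p : s t / s <= t}}.
  exact: gt0_ler_poweR (ltW p0).
have pow_nd i j : (i <= j)%N ->
    (slope j.+1%:R^-1 u z) `^ p <= (slope i.+1%:R^-1 u z) `^ p.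
  move=> ij; apply: pow_mono; rewrite ?in_itv/= ?slope_ge0 ?leey//.
  exact: slope_mono.
rewrite (_ : lip u z `^ p = ereal_inf (range (fun n => (slope n.+1%:R^-1 u z) `^ p))).
  exact: ereal_nonincreasing_cvgn.
apply/eqP; rewrite eq_le; apply/andP; split.
  apply: le_ereal_inf_tmp => _ [n _ <-].
  by apply: pow_mono; rewrite ?in_itv/= ?slope_ge0 ?lip_ge0 ?leey// lip_le_slope.
set L := ereal_inf _; rewrite leNgt; apply/negP => lipL.
have L_le n : L <= (slope n.+1%:R^-1 u z) `^ p by apply: ereal_inf_lbound; exists n.
have lip_lt : lip u z < L `^ p^-1.
  rewrite ltNge; apply/negP => Llip; move: lipL; rewrite ltNge => /negP; apply.
  have L0 : 0 <= L by apply: le_ereal_inf_tmp => _ [n _ <-]; exact: poweR_ge0.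
  rewrite -[L]poweRe1// -(mulVf (lt0r_neq0 p0)) poweRrM.
  by apply: pow_mono; rewrite ?in_itv/= ?poweR_ge0 ?lip_ge0 ?leey.
have [n nL] : exists n, slope n.+1%:R^-1 u z < L `^ p^-1.
  have : \forall n \near \oo, slope n.+1%:R^-1 u z < L `^ p^-1.
    exact: (cvg_slope_lip (open_ereal_lt' lip_lt)).
  by move=> [n _ /(_ n (leqnn n))]; exists n.
move: nL; rewrite ltNge => /negP; apply.
rewrite (_ : slope _ u z = (slope n.+1%:R^-1 u z `^ p) `^ p^-1); last first.
  by rewrite -poweRrM mulfV ?lt0r_neq0// poweRe1// slope_ge0.
apply: gt0_ler_poweR; last exact: L_le.
- by rewrite invr_ge0 ltW.
- rewrite in_itv/= leey andbT.
  by apply: le_ereal_inf_tmp => _ [k _ <-]; exact: poweR_ge0.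
- by rewrite in_itv/= leey poweR_ge0.
Qed.

Lemma cvg_integral_slope_lip_pow (u : X -> R) : Lipschitz u ->
  \int[nu]_z (slope n.+1%:R^-1 u z `^ p) @[n --> \oo] -->
  \int[nu]_z (lip u z `^ p).
Proof.
move=> uL; have [K uK] := uL.
have uK' a b : (`|u a - u b| <= `|K| * mdist a b)%R.
  by apply: (le_trans (uK a b)); rewrite ler_wpM2r ?mdist_ge0// ler_norm.
have ms n : measurable_fun setT
    ((fun z => slope n.+1%:R^-1 u z `^ p) : caratheodory_type m -> \bar R).
  apply: measurable_fun_cara_pow.
  by case: (borel_nonneg_slope n.+1%:R^-1 (Lipschitz_continuous uL)).
have ml : measurable_fun setT
    ((fun z => lip u z `^ p) : caratheodory_type m -> \bar R).
  by apply: measurable_fun_cara_pow; exact: measurable_lip.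
have [|||//] := @dominated_convergence _ (caratheodory_type m) R nu setT measurableT
  _ _ (fun=> (`|K| `^ p)%:E) ms ml.
- by apply/aeW => z _; exact: cvg_slope_lip_pow.
- apply/integrableP; split => //.
  by rewrite integral_cst//= lte_mul_pinfty// lee_fin.
- apply/aeW => z n _; rewrite gee0_abs ?poweR_ge0//.
  rewrite -poweR_EFin; apply: gt0_ler_poweR.
  + exact: ltW.
  + by rewrite in_itv/= slope_ge0 leey.
  + by rewrite in_itv/= lee_fin normr_ge0 leey.
  + exact: slope_le_Lipschitz.
Qed.

Variables (x y : X) (C : R).
Hypothesis C0 : (0 < C)%R.
Hypothesis poincare : forall u : X -> R, Lipschitz u ->
  (`|u x - u y| `^ p)%:E <= C%:E * \int[nu]_z (lip u z `^ p).

Let T : R := (2 + 2 * fine (nu setT))%R.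
Let L : R := ((C * T) `^ p^-1 + 1)%R.

Let L0 : (0 < L)%R. Proof. by rewrite ltr_wpDl// powR_ge0. Qed.

(** Test the inequality with the potential u of x: it vanishes at x, and the density g
    bounds lip u. As the truncation level L exceeds the resulting bound on u y, the
    value u y is nearly attained by chains. *)
Let cheap_chain (g : X -> R) (e J : R) : (0 < e)%R ->
  (forall z, (0 <= g z)%R) -> (forall z, (g z <= J)%R) ->
  (forall z w, (`|g z - g w| <= J * mdist z w)%R) ->
  \int[nu]_z ((g z)%:E `^ p) <= T%:E ->
  exists2 s, chains e x y s & (chain_cost g x s < L)%R.
Proof.
move=> e0 g0 gJ gL gT; pose u := potential g e L x.
have uL : Lipschitz u by exact: (Lipschitz_potential _ g0 e0 (ltW L0) gJ).
have := poincare uL.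
rewrite /u (potential_origin _ _ g0 (ltW L0)) -/u sub0r normrN.
rewrite ger0_norm; last exact: (potential_ge0 _ _ g0 (ltW L0)).
have gB : borel_nonneg (EFin \o g) by apply: Lipschitz_borel => //; exists J.
have lip_g : \int[nu]_z (lip u z `^ p) <= T%:E.
  apply: le_trans gT; apply: ge0_le_integral => //.
  - by move=> z _; exact: poweR_ge0.
  - by apply: measurable_fun_cara_pow; exact: measurable_lip.
  - exact: (measurable_fun_cara_pow gB.2).
  - move=> z _; apply: gt0_ler_poweR; rewrite ?(ltW p0)// ?in_itv/= ?leey ?andbT.
    + exact: lip_ge0.
    + by rewrite lee_fin.
    + exact: (lip_potential _ g0 e0 (ltW L0) gL).
move=> /le_trans => /(_ (C * T)%:E) H.
have {}H : (u y `^ p <= C * T)%R.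
  by rewrite -lee_fin; apply: H; rewrite EFinM lee_wpmul2l// lee_fin ltW.
have uy : (u y < L)%R.
  apply: (@le_lt_trans _ _ ((C * T) `^ p^-1)%R); last by rewrite ltrDl.
  have uy0 : (0 <= u y)%R by exact: (potential_ge0 _ _ g0 (ltW L0)).
  rewrite -[leLHS]powRr1// -(mulfV (lt0r_neq0 p0)) powRrM.
  apply: ge0_ler_powR => //; rewrite ?nnegrE ?powR_ge0 ?invr_ge0 ?(ltW p0)//.
  exact: le_trans (powR_ge0 _ _) H.
exact: (potential_chain g0 (ltW L0) (lexx _) uy).
Qed.

(** The density is at least 1 after passing to the majorant h, so that the length of a
    chain is at most its cost. Chains that are cheap for the Lipschitz approximations
    of h converge to a curve along which the integrals of these approximations are
    bounded, and monotone convergence gives the integral of h. *)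
Lemma short_curve_unit (g : X -> \bar R) : borel_nonneg g ->
  \int[nu]_z (g z `^ p) <= 1 ->
  exists f : R -> X, [/\ f 0%R = x, f L = y, curve f 0%R L, rectifiable f 0%R L &
    curve_length f 0%R L <= L%:E /\ curve_integral g f 0%R L <= L%:E].
Proof.
move=> gb gp1.
have [h [H [h1 ho gh [mH H0 hH HT]]]] := lsc_majorant hm nufin p0 gb.
have {}HT : \int[nu]_z H z <= T%:E.
  apply: (le_trans HT); apply: (le_trans (leeD gp1 (lexx _))).
  by rewrite -EFinD lee_fin /T; lra.
pose G k := lip_approx h k.
have G0 k z : (0 <= G k z)%R by exact: le_trans (lip_approx_ge1 h1 k z).
have GL k z w : (`|G k z - G k w| <= k.+1%:R * mdist z w)%R.
  exact: lip_approx_Lipschitz.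
have Gb k : borel_nonneg (EFin \o G k).
  by apply: Lipschitz_borel => //; exists k.+1%:R; exact: GL.
have GT k : \int[nu]_z ((G k z)%:E `^ p) <= T%:E.
  apply: le_trans HT; apply: ge0_le_integral => //.
  - by move=> z _; exact: poweR_ge0.
  - exact: (measurable_fun_cara_pow (Gb k).2).
  - by move=> z _; rewrite poweR_EFin; apply: hH => //; exact: lip_approx_le_fun.
(* G k is at most k + 1: a step of length e k costs at most 1 / (k + 1) *)
pose e (k : nat) : R := (k.+1%:R^-1 ^+ 2)%R.
have e0 k : (0 < e k)%R by rewrite exprn_gt0// invr_gt0.
have cP k := cheap_chain (e0 k) (G0 k) (lip_approx_le h1 k) (GL k) (GT k).
pose c k := s2val (cid2 (cP k)).
have c_chain k : chains (e k) x y (c k) by exact: s2valP (cid2 (cP k)).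
have c_cost k : (chain_cost (G k) x (c k) <= L)%R.
  exact/ltW/(s2valP' (cid2 (cP k))).
have c_step k : path (fun a b => step_cost (G k) a b <= k.+1%:R^-1)%R x (c k).
  have [+ _] := c_chain k; apply: sub_path => a b ab; rewrite /step_cost.
  have -> : (k.+1%:R^-1 = k.+1%:R * e k :> R)%R.
    by rewrite /e expr2 mulrA mulfV ?mul1r// pnatr_eq0.
  apply: ler_pM => //; first by rewrite divr_ge0// addr_ge0.
    exact: mdist_ge0.
  by have := lip_approx_le h1 k a; have := lip_approx_le h1 k b; rewrite /G; lra.
have [f [f0 fL fP]] := limit_curve hm hD (lip_approx_ge1 h1)
  (lip_approx_nd h1) GL (fun k => (c_chain k).2) c_cost c_step.
have f1 t t' : (0 <= t)%R -> (t <= t')%R -> (t' <= L)%R ->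
  (mdist (f t) (f t') <= t' - t)%R by move=> *; apply fP.
have fc := curve_1Lipschitz (ltW L0) f1.
have fr := rectifiable_1Lipschitz (ltW L0) f1.
exists f; split => //; split.
  by rewrite -[L in leRHS]subr0; exact: (curve_length_1Lipschitz f1 _ (ltW L0)).
have GI k : curve_integral (EFin \o G k) f 0%R L <= L%:E.
  apply: (curve_integral_le_duration (ltW L0) f1 _ (G0 k) (GL k)) => //.
  by move=> t t' t0 tt' t'L; have [_] := fP t t' t0 tt' t'L; exact.
have hb : measurable_fun setT (h : g_sigma_algebraType (@open X) -> \bar R).
  by apply: lsc_measurable => a; apply: open_borel; exact: ho.
have mP (q : X -> \bar R) :
    measurable_fun setT (q : g_sigma_algebraType (@open X) -> \bar R) ->
    measurable_fun `[0%R, fine (curve_length f 0 L)]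
      (q \o arc_length_param f 0 L).
  by move=> mq; exact: (measurable_arc_length_param fc fr mq).
apply: (@le_trans _ _ (curve_integral h f 0%R L)).
  apply: ge0_le_integral => //.
  - by move=> t _; exact: gb.1.
  - exact: mP gb.2.
  - exact: mP hb.
have := @cvg_monotone_convergence _ _ R lebesgue_measure
  `[0%R, fine (curve_length f 0 L)] (measurable_itv _)
  (fun k => (EFin \o G k) \o arc_length_param f 0 L).
have -> : (fun t => limn (fun k => ((EFin \o G k) \o arc_length_param f 0 L) t)) =
    h \o arc_length_param f 0 L.
  apply/funext => t; apply/cvg_lim => //; exact: cvg_lip_approx.
move=> cvgI.
have {}cvgI : curve_integral (EFin \o G k) f 0%R L @[k --> \oo] -->
    curve_integral h f 0%R L.
  apply: cvgI => //.
  - by move=> k; exact: mP (Gb k).2.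
  - by move=> k t _; exact: (Gb k).1.
  - by move=> t _ i j ij; rewrite lee_fin lip_approx_nd.
rewrite -(cvg_lim _ cvgI)//; apply: lime_le; first by apply/cvg_ex; eexists; exact: cvgI.
exact: nearW.
Qed.

(** By homogeneity: rescale the density so that its integral becomes at most 1. *)
Lemma short_curve : exists2 B : R, (0 < B)%R &
  forall (g : X -> \bar R) (t : R), borel_nonneg g -> (0 < t)%R ->
    \int[nu]_z (g z `^ p) <= t%:E ->
  exists (f : R -> X) (b : R), [/\ f 0%R = x, f b = y, curve f 0%R b,
    rectifiable f 0%R b & curve_length f 0%R b <= B%:E /\
    curve_integral g f 0%R b <= (B * t `^ p^-1)%:E].
Proof.
exists L => // g t gb t0 gt.
pose k : R := ((t `^ p^-1)^-1)%R.
have tp0 : (0 < t `^ p^-1)%R by exact: powR_gt0.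
have k0 : (0 < k)%R by rewrite invr_gt0.
have kp : (k `^ p = t^-1)%R.
  rewrite /k -powR_inv1 ?powR_ge0// -!powRrM mulN1r mulrN mulVf ?lt0r_neq0//.
  by rewrite powR_inv1// ltW.
have kgb := borel_nonnegZ (ltW k0) gb.
have [|f [f0 fL fc fr [fl fI]]] := short_curve_unit kgb.
  have -> : \int[nu]_z ((k%:E * g z) `^ p) = \int[nu]_z (t^-1%:E * (g z `^ p)).
    apply: eq_integral => z _; rewrite poweRM ?lee_fin ?(ltW k0)//; last exact: gb.1.
    by rewrite poweR_EFin kp.
  rewrite ge0_integralZl//.
  - by rewrite lee_pdivrMl// mule1.
  - exact: (measurable_fun_cara_pow gb.2).
  - by move=> z _; exact: poweR_ge0.
  - by rewrite lee_fin invr_ge0 ltW.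
exists f, L; split => //; split => //.
move: fI; rewrite (curve_integralZ (ltW k0) gb fc fr).
by rewrite lee_pdivrMl// muleC -EFinM mulrC.
Qed.

End poincare_curves.

(** * Finiteness of the Riesz measure *)

Section riesz_measure.
Context {R : realType} {X : completeMetricType R}.
Variable m : {outer_measure set X -> \bar R}.
Hypotheses (hm : metric_measure_space m) (hD : doubling m).

Let mu := (m : {measure set (caratheodory_type m) -> \bar R}).

Definition ball_mass (x : X) (r : R) : R := fine (m (ball x r)).

Let ball_massE x r : (ball_mass x r)%:E = m (ball x r).
Proof. by rewrite fineK// ge0_fin_numE ?outer_measure_ge0// measure_ball_lty. Qed.

Let ball_mass_gt0 x r : (0 < r)%R -> (0 < ball_mass x r)%R.
Proof. by move=> r0; rewrite -lte_fin ball_massE measure_ball_gt0. Qed.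

Let ball_mass_nd x r r' : (r <= r')%R -> (ball_mass x r <= ball_mass x r')%R.
Proof.
move=> rr'; rewrite -lee_fin !ball_massE; apply: le_outer_measure => z.
by rewrite !ballEmdist => /lt_le_trans; apply.
Qed.

(** With 0 / 0 = 0 this real function has the value 0 at x, as has the quotient of
    extended reals, where 0 / 0 is 0 times +oo. *)
Definition riesz_pole (x z : X) : R := (mdist x z / ball_mass x (mdist x z))%R.

Let riesz_pole_ge0 x z : (0 <= riesz_pole x z)%R.
Proof.
have [<-|xz] := eqVneq x z; first by rewrite /riesz_pole mdistxx mul0r.
by rewrite divr_ge0 ?mdist_ge0// ltW// ball_mass_gt0// mdist_gt0.
Qed.

Let riesz_poleE x z :
  (riesz_pole x z)%:E = (mdist x z)%:E / m (ball x (mdist x z)).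
Proof.
have [<-|xz] := eqVneq x z; first by rewrite /riesz_pole mdistxx mul0r mul0e.
rewrite -ball_massE inver gt_eqF ?ball_mass_gt0 ?mdist_gt0//.
Qed.

Let measurable_mdist (x : X) :
  measurable_fun setT (mdist x : g_sigma_algebraType (@open X) -> R).
Proof.
apply/measurable_EFinP; apply: lsc_measurable => a; apply: open_borel.
exact: open_mdist_gt.
Qed.

Let measurable_riesz_pole (x : X) :
  measurable_fun setT (riesz_pole x : g_sigma_algebraType (@open X) -> R).
Proof.
rewrite (_ : riesz_pole x = fun z => mdist x z * (ball_mass x (mdist x z)) `^ (-1))%R.
  apply: measurable_funM => //.
  apply: (measurableT_comp (measurable_powR _)).
  apply: (measurableT_comp _ (measurable_mdist x)).
  by apply: nondecreasing_measurable => // r r' *; exact: ball_mass_nd.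
apply/funext => z; rewrite powR_inv1// fine_ge0//; exact: outer_measure_ge0.
Qed.

(** Cut the ball into dyadic annuli: on the n-th one the pole is at most a constant
    times 2^-n r divided by the mass of the ball of radius 2^-n r, so that its
    integral there is at most a constant times 2^-n r. *)
Let integral_riesz_pole_lty (x : X) (r : R) : (0 < r)%R ->
  \int[mu]_z (riesz_pole x z * \1_(ball x r) z)%:E < +oo.
Proof.
move=> r0; case: hD => CD CD1 D; have CD0 : (0 <= CD)%R by exact: le_trans CD1.
pose rn (n : nat) : R := (r / 2 ^+ n)%R.
have rn0 n : (0 < rn n)%R by rewrite divr_gt0// exprn_gt0.
pose c n : R := (rn n * CD / ball_mass x (rn n))%R.
have c0 n : (0 <= c n)%R.
  by rewrite divr_ge0 ?mulr_ge0 ?(ltW (rn0 _))// ltW// ball_mass_gt0.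
have mball s : measurable (ball x s : set (caratheodory_type m)).
  exact: (ball_cara hm).
have mc n : measurable_fun setT
    ((fun z => (c n * \1_(ball x (rn n)) z)%:E) : caratheodory_type m -> \bar R).
  by apply/measurable_EFinP; apply: measurable_funM => //; exact: measurable_indic.
have le_c z : (riesz_pole x z * \1_(ball x r) z)%:E <=
    \sum_(n <oo) (c n * \1_(ball x (rn n)) z)%:E.
  have c_ge0 n : 0 <= (c n * \1_(ball x (rn n)) z)%:E.
    by rewrite lee_fin mulr_ge0// indicE.
  have S0 : 0 <= \sum_(n <oo) (c n * \1_(ball x (rn n)) z)%:E.
    by apply: nneseries_ge0 => n _ _.
  have [xz|xz] := eqVneq x z.
    by rewrite (_ : riesz_pole x z = 0%R) ?mul0r// /riesz_pole xz mdistxx mul0r.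
  have d0 : (0 < mdist x z)%R by rewrite mdist_gt0.
  rewrite indicE; case: (boolP (z \in _)) => [|_]; last first.
    by rewrite mulr0.
  rewrite inE ballEmdist/= mulr1 => zr.
  have ex_n : exists n, (rn n.+1 <= mdist x z)%R.
    exists (Num.truncn (r / mdist x z)); rewrite /rn ler_pdivrMr ?exprn_gt0//.
    rewrite mulrC -ler_pdivrMr//.
    apply: (le_trans (ltW (Num.Theory.truncnS_gt _))).
    by set k := _.+1; rewrite -natrX ler_nat; exact/ltnW/ltn_expl.
  case: (ex_minnP ex_n) => n ndn nmin.
  have dn : (mdist x z < rn n)%R.
    case: n {ndn} nmin => [_|n nmin]; first by rewrite /rn expr0 divr1.
    by rewrite ltNge; apply/negP => /nmin; rewrite ltnn.
  apply: (@le_trans _ _ (\sum_(0 <= i < n.+1) (c i * \1_(ball x (rn i)) z)%:E)).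
    rewrite big_nat_recr//= indicE mem_set ?ballEmdist//= mulr1.
    apply: le_trans (leeDr _ _); last exact: sume_ge0.
    rewrite lee_fin /riesz_pole /c ler_pdivlMr ?ball_mass_gt0// mulrAC.
    rewrite ler_pdivrMr ?ball_mass_gt0//.
    have D1 : (ball_mass x (rn n) <= CD * ball_mass x (rn n.+1))%R.
      rewrite -lee_fin EFinM !ball_massE; apply: le_trans (D x _ (rn0 n.+1)).
      by rewrite /rn exprS invfM mulrCA mulVKf// pnatr_eq0.
    have D2 : (ball_mass x (rn n.+1) <= ball_mass x (mdist x z))%R.
      exact: ball_mass_nd.
    rewrite -mulrA; apply: ler_pM; rewrite ?(ltW d0) ?(ltW dn)//.
      by rewrite ltW// ball_mass_gt0.
    by apply: (le_trans D1); rewrite ler_wpM2l.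
  exact: nneseries_lim_ge.
apply: (@le_lt_trans _ _ (\int[mu]_z \sum_(n <oo) (c n * \1_(ball x (rn n)) z)%:E)).
  apply: ge0_le_integral => //.
  - by move=> z _; rewrite lee_fin mulr_ge0// indicE.
  - apply/measurable_EFinP; apply: measurable_funM; last exact: measurable_indic.
    apply/measurable_EFinP; apply: (measurable_fun_cara hm).
    exact/measurable_EFinP.
  - apply: ge0_emeasurable_sum => // n z _ _.
    by rewrite lee_fin mulr_ge0// indicE.
rewrite integral_nneseries//; last first.
  by move=> n z _; rewrite lee_fin mulr_ge0// indicE.
apply: (@le_lt_trans _ _ (2 * r * CD)%:E); last exact: ltry.
(* 2 r CD / 2 ^ (n + 1) = 2 ^ -n r CD is the contribution of the n-th annulus *)
apply: le_trans (epsilon_trick0 xpredT _); last by rewrite !mulr_ge0// ltW.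
apply: lee_nneseries => [n _ _|n _].
  by apply: integral_ge0 => z _; rewrite lee_fin mulr_ge0// indicE.
rewrite (eq_integral (fun z : caratheodory_type m => (c n)%:E * (\1_(ball x (rn n)) z)%:E)); last first.
  by move=> z _; rewrite EFinM.
rewrite ge0_integralZl//; last 2 first.
  by apply/measurable_EFinP; exact: measurable_indic.
  by rewrite lee_fin.
rewrite integral_indic// setIT.
have -> : mu (ball x (rn n)) = (ball_mass x (rn n))%:E by rewrite ball_massE.
rewrite -EFinM lee_fin /c divfK ?gt_eqF ?ball_mass_gt0//.
by rewrite /rn natrX exprS invfM; lra.
Qed.

Variables (L : R) (x y : X).
Hypothesis L1 : (1 <= L)%R.

Let S : set X := (ball x (L * mdist x y)%R `|` ball y (L * mdist x y)%R) `&`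
  ([set z | (0 < mdist x z)%R] `&` [set z | (0 < mdist y z)%R]).

Let riesz_kernelE z : riesz_kernel m L x y z =
  ((riesz_pole x z + riesz_pole y z) * \1_S z)%:E.
Proof.
rewrite /riesz_kernel; case: ifPn => [|].
  move=> zxy; rewrite indicE memNset ?mulr0// => -[_ []] /=.
  by rewrite !mdist_gt0; case/orP: zxy => /eqP ->; rewrite eqxx.
rewrite negb_or => /andP[zx zy].
rewrite -!riesz_poleE -EFinD -EFinM; congr (_ * _)%:E.
rewrite !indicE; congr ((_ : bool)%:R); apply/idP/idP; rewrite !inE.
  by move=> H; split => //; split => /=; rewrite mdist_gt0 eq_sym.
by case.
Qed.

Let riesz_kernel_ge0 z : 0 <= riesz_kernel m L x y z.
Proof. by rewrite riesz_kernelE lee_fin mulr_ge0 ?addr_ge0// indicE. Qed.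

Let openS : open S.
Proof.
apply: openI; first by apply: openU; exact: ball_open_metric.
by apply: openI; exact: open_mdist_gt.
Qed.

Let measurable_riesz_kernel :
  measurable_fun setT (riesz_kernel m L x y : caratheodory_type m -> \bar R).
Proof.
apply: (measurable_fun_cara hm).
rewrite (_ : riesz_kernel m L x y = EFin \o
  (fun z => (riesz_pole x z + riesz_pole y z) * \1_S z))%R.
  apply/measurable_EFinP; apply: measurable_funM; first exact: measurable_funD.
  by apply: measurable_indic; exact: open_borel.
by apply/funext => z; rewrite riesz_kernelE.
Qed.

Let riesz_measure_lty : riesz_measure m L x y setT < +oo.
Proof.
have d0 := mdist_ge0 x y; pose r := ((L + 1) * mdist x y + 1)%R.
have r0 : (0 < r)%R by rewrite ltr_wpDl// mulr_ge0// addr_ge0// (le_trans ler01).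
have mp q : measurable_fun setT
    ((fun z => (riesz_pole q z * \1_(ball q r) z)%:E) : caratheodory_type m -> \bar R).
  apply: (measurable_fun_cara hm); apply/measurable_EFinP.
  apply: measurable_funM => //; apply: measurable_indic; apply: open_borel.
  exact: ball_open_metric.
have p0 q z : 0 <= (riesz_pole q z * \1_(ball q r) z)%:E.
  by rewrite lee_fin mulr_ge0// indicE.
apply: (@le_lt_trans _ _ (\int[mu]_z ((riesz_pole x z * \1_(ball x r) z)%:E +
    (riesz_pole y z * \1_(ball y r) z)%:E))).
  apply: ge0_le_integral => //; first exact: emeasurable_funD.
  move=> z _; rewrite riesz_kernelE -EFinD lee_fin indicE.
  case: (boolP (z \in S)) => [|_]; last first.
    by rewrite mulr0 addr_ge0// -lee_fin.
  rewrite inE => -[zB _]; rewrite mulr1 !indicE !mem_set ?mulr1//.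
    rewrite ballEmdist/= /r; case: zB; rewrite ballEmdist/= => zB.
      by have := metric_triangle y x z; rewrite (metric_sym y x); lra.
    by lra.
  rewrite ballEmdist/= /r; case: zB; rewrite ballEmdist/= => zB; first by lra.
  by have := metric_triangle x y z; lra.
rewrite ge0_integralD//.
by apply: lte_add_pinfty; exact: integral_riesz_pole_lty.
Qed.

(** The kernel is at most the sum of the two poles, each cut off at a ball that contains
    both of the balls of the kernel. *)
Lemma riesz_measure_finite_measure :
  exists2 nu : {measure set (caratheodory_type m) -> \bar R},
    nu setT < +oo & (nu : set _ -> \bar R) = riesz_measure m L x y.
Proof.
have r0 : riesz_measure m L x y set0 = 0 by exact: integral_set0.
have rge0 A : 0 <= riesz_measure m L x y A by apply: integral_ge0.
have rsigma : semi_sigma_additive (riesz_measure m L x y).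
  exact: semi_sigma_additive_nng_induced.
pose nu : {measure set (caratheodory_type m) -> \bar R} :=
  HB.pack (riesz_measure m L x y)
    (@isMeasure.Build _ (caratheodory_type m) R (riesz_measure m L x y) r0 rge0 rsigma).
by exists nu.
Qed.

End riesz_measure.

(** * The equivalence *)

Section equivalence.
Context {R : realType} {X : completeMetricType R}.
Variable m : {outer_measure set X -> \bar R}.
Hypotheses (hm : metric_measure_space m) (hD : doubling m).
Variables (p : R) (x y : X).
Hypothesis p1 : (1 <= p)%R.

Let p0 : (0 < p)%R. Proof. exact: lt_le_trans p1. Qed.

Let le_poweR (a b : \bar R) : 0 <= a -> a <= b -> a `^ p <= b `^ p.
Proof.
move=> a0 ab; apply: gt0_ler_poweR; rewrite ?(ltW p0)// in_itv/= leey andbT//.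
exact: le_trans ab.
Qed.

Let le_real_pow (a : R) (b : \bar R) : (0 <= a)%R -> a%:E <= b ->
  (a `^ p)%:E <= b `^ p.
Proof. by move=> a0 ab; rewrite -poweR_EFin le_poweR// lee_fin. Qed.

Lemma chain_integral_ge0 (g : X -> \bar R) q s : (forall z, 0 <= g z) ->
  0 <= chain_integral g q s.
Proof.
move=> g0; elim: s q => [q|z s ih q]; first by rewrite /chain_integral/= big_nil.
rewrite chain_integral_cons adde_ge0// mule_ge0 ?lee_fin ?mdist_ge0//.
by rewrite mule_ge0// ?adde_ge0// inver pnatr_eq0/= lee_fin.
Qed.

Definition least_integral (C : R) (g : X -> \bar R) (e : R) :=
  ereal_inf [set chain_integral g x c `^ p
            | c in [set c | chains e x y c /\ (chain_length x c <= C * mdist x y)%R]].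

(** As e decreases there are fewer chains. *)
Lemma is_cvg_least_integral C g : cvg (least_integral C g e @[e --> (0 : R)^'+]).
Proof.
apply: nonincreasing_at_right_is_cvge; apply: nearW => b e e' _ _ ee'.
apply: ereal_inf_le_tmp => _ [c [[cp cl] lc] <-]; exists c => //; split => //.
by split => //; apply: sub_path cp => u v /le_trans; apply.
Qed.

Lemma least_integral_lim_le C g (B : \bar R) :
  (forall e, (0 < e)%R -> least_integral C g e <= B) ->
  lim (least_integral C g e @[e --> (0 : R)^'+]) <= B.
Proof.
move=> H; apply: lime_le; first exact: is_cvg_least_integral.
near=> e; apply: H; near: e; exact: nbhs_right_gt.
Unshelve. all: by end_near. Qed.

Lemma least_integral_lim_ge C g (B : \bar R) (e : R) : (0 < e)%R ->
  (forall e', (0 < e')%R -> (e' <= e)%R -> B <= least_integral C g e') ->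
  B <= lim (least_integral C g e @[e --> (0 : R)^'+]).
Proof.
move=> e0 H; apply: lime_ge; first exact: is_cvg_least_integral.
near=> e'; apply: H; near: e'; first exact: nbhs_right_gt.
exact: nbhs_right_le.
Unshelve. all: by end_near. Qed.

Definition lip_poincare (C L : R) := forall u : X -> R, Lipschitz u ->
  (`|u x - u y| `^ p)%:E <=
  C%:E * \int[riesz_measure m L x y]_z (lip u z `^ p).

Definition slope_poincare (C L : R) := forall u : X -> R, Lipschitz u ->
  forall n, (`|u x - u y| `^ p)%:E <=
  C%:E * \int[riesz_measure m L x y]_z (slope n.+1%:R^-1 u z `^ p).

Definition joined_by_short_curves (L : R) := exists2 B : R, (0 < B)%R &
  forall (g : X -> \bar R) (t : R), borel_nonneg g -> (0 < t)%R ->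
    \int[riesz_measure m L x y]_z (g z `^ p) <= t%:E ->
  exists (f : R -> X) (b : R), [/\ f 0%R = x, f b = y, curve f 0%R b,
    rectifiable f 0%R b & curve_length f 0%R b <= B%:E /\
    curve_integral g f 0%R b <= (B * t `^ p^-1)%:E].

Lemma riesz_integral_pow_ge0 (L : R) (g : X -> \bar R) : (1 <= L)%R ->
  0 <= \int[riesz_measure m L x y]_z (g z `^ p).
Proof.
move=> L1; have [nu _ <-] := riesz_measure_finite_measure hm hD x y L1.
by apply: integral_ge0 => z _; exact: poweR_ge0.
Qed.

(** Let the scale of the slopes tend to 0, by dominated convergence. *)
Lemma slope_poincare_lip (C L : R) : (1 <= L)%R ->
  slope_poincare C L -> lip_poincare C L.
Proof.
move=> L1 H u uL; have [nu nufin nuE] := riesz_measure_finite_measure hm hD x y L1.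
rewrite -nuE; have := cvg_integral_slope_lip_pow hm nufin p1 uL.
move=> /(cvgeZl (y := C%:E) isT) cv; rewrite -(cvg_lim _ cv)//.
apply: lime_ge; first by apply/cvg_ex; eexists; exact: cv.
by apply: nearW => n; rewrite nuE; exact: H.
Qed.

Lemma lip_poincare_short_curves (C L : R) : (0 < C)%R -> (1 <= L)%R ->
  lip_poincare C L -> joined_by_short_curves L.
Proof.
move=> C0 L1 H; have [nu nufin nuE] := riesz_measure_finite_measure hm hD x y L1.
rewrite /joined_by_short_curves -nuE; apply: (short_curve hm hD nufin p1 C0).
by move=> u uL; rewrite nuE; exact: H.
Qed.

Let slope_UG_eps (u : X -> R) (n : nat) : Lipschitz u ->
  UG_eps (n.+2%:R^-1) u (slope n.+1%:R^-1 u).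
Proof.
move=> uL; split; first exact/borel_nonneg_slope/Lipschitz_continuous.
apply: eps_chain_le_UG_eps; first exact: slope_ge0.
move=> a b ab; apply: le_slope_mdist; apply: (le_lt_trans ab).
by rewrite ltf_pV2 ?posrE// ltr_nat.
Qed.

Let slope_lty (u : X -> R) r z : Lipschitz u -> slope r u z < +oo.
Proof.
move=> [K uK]; apply: (@le_lt_trans _ _ (`|K|)%:E); last exact: ltry.
apply: slope_le_Lipschitz => // a b; apply: (le_trans (uK a b)).
by rewrite ler_wpM2r ?mdist_ge0// ler_norm.
Qed.

Hypothesis xy : x != y.

Let d0 : (0 < mdist x y)%R. Proof. by rewrite mdist_gt0. Qed.

Let D : R := (mdist x y `^ (p - 1))%R.

Let D0 : (0 < D)%R. Proof. by rewrite powR_gt0. Qed.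

(** Going to numbers t > I allows I = 0 without a special case. *)
Let real_approx (I : \bar R) (C : R) (F : \bar R) : 0 <= I -> (0 < C)%R ->
  (forall t : R, (0 < t)%R -> I <= t%:E -> F <= (C * t)%:E) -> F <= C%:E * I.
Proof.
move=> I0 C0 H; case: I I0 H => [i i0 H|_ _|//]; last first.
  by rewrite gt0_muley ?lte_fin// leey.
apply/lee_addgt0Pr => e e0; rewrite -EFinM -EFinD.
have -> : (C * i + e = C * (i + e / C))%R by field; rewrite gt_eqF.
apply: H; first by rewrite ltr_wpDl ?divr_gt0.
by rewrite lee_fin lerDl ltW// divr_gt0.
Qed.

Let pow_bound (B t : R) : (0 < B)%R -> (0 < t)%R ->
  ((B * t `^ p^-1) `^ p = B `^ p * t)%R.
Proof.
move=> B0 t0; rewrite powRM ?powR_ge0 ?(ltW B0)//.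
by rewrite -powRrM mulVf ?gt_eqF// powRr1// ltW.
Qed.

(** Chains along the curve, with the p-th root of the bound as the tolerance: the
    constants 2 and 1 add up to 3. *)
Lemma short_curves_chains (L : R) : (1 <= L)%R -> joined_by_short_curves L ->
  exists2 C : R, (0 < C)%R &
    forall g : X -> \bar R, borel_nonneg g -> g x < +oo -> g y < +oo ->
    lim (least_integral C g e @[e --> (0 : R)^'+]) <=
    (C * D)%:E * \int[riesz_measure m L x y]_z (g z `^ p).
Proof.
move=> L1 [B B0 curves]; pose C := (B / mdist x y + (3 * B) `^ p / D)%R.
have C10 : (0 < B / mdist x y)%R by rewrite divr_gt0.
have B30 : (0 < (3 * B) `^ p)%R by rewrite powR_gt0// mulr_gt0.
have C20 : (0 < (3 * B) `^ p / D)%R by rewrite divr_gt0.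
have C0 : (0 < C)%R by rewrite addr_gt0.
exists C => // g gb gx gy; apply: least_integral_lim_le => e e0.
apply: real_approx; first exact: riesz_integral_pow_ge0.
  by rewrite mulr_gt0.
move=> t t0 gt; have [f [b [f0 fb fc fr [fl fI]]]] := curves g t gb t0 gt.
have Bt0 : (0 < B * t `^ p^-1)%R by rewrite mulr_gt0// powR_gt0.
have [|||c [cc cl cI]] := curve_chain fc fr gb _ _ _ e0 Bt0.
- by rewrite (le_lt_trans fI)// ltry.
- by rewrite f0.
- by rewrite fb.
rewrite f0 fb in cc cl cI.
apply: ge_ereal_inf; exists (chain_integral g x c `^ p).
  exists c => //; split => //.
  rewrite -lee_fin (le_trans cl)// (le_trans fl)// lee_fin /C mulrDl divfK ?gt_eqF//.
  by rewrite lerDl mulr_ge0 ?mdist_ge0// ltW.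
apply: (@le_trans _ _ (((3 * B) * t `^ p^-1) `^ p)%:E).
  rewrite -poweR_EFin; apply: le_poweR; first exact: (chain_integral_ge0 _ _ gb.1).
  apply: (le_trans cI); rewrite (_ : (3 * B * t `^ p^-1)%:E =
    2%:E * (B * t `^ p^-1)%:E + (B * t `^ p^-1)%:E); last first.
    by rewrite -EFinM -EFinD; congr EFin; lra.
  by rewrite leeD2r// lee_wpmul2l.
rewrite lee_fin pow_bound ?mulr_gt0// ler_wpM2r ?(ltW t0)//.
by rewrite /C [leRHS]mulrDl [X in (_ <= _ + X)%R]divfK ?gt_eqF// lerDr mulr_ge0// ltW.
Qed.

Lemma short_curves_UG (L : R) : (1 <= L)%R -> joined_by_short_curves L ->
  exists2 C : R, (0 < C)%R & forall (u : X -> R) (g : X -> \bar R), UG u g ->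
    (`|u x - u y| `^ p)%:E <=
    (C * D)%:E * \int[riesz_measure m L x y]_z (g z `^ p).
Proof.
move=> L1 [B B0 curves]; have Bp0 : (0 < B `^ p)%R by rewrite powR_gt0.
exists (B `^ p / D)%R; first by rewrite divr_gt0.
move=> u g [gb ug]; rewrite divfK ?gt_eqF//.
apply: real_approx => //; first exact: riesz_integral_pow_ge0.
move=> t t0 gt; have [f [b [f0 fb fc fr [_ fI]]]] := curves g t gb t0 gt.
have := le_trans (ug f 0%R b fc fr) fI; rewrite f0 fb lee_fin distrC => h.
rewrite lee_fin -pow_bound//; apply: ge0_ler_powR; rewrite ?nnegrE ?(ltW p0)//.
by rewrite mulr_ge0 ?powR_ge0// ltW.
Qed.

Lemma chains_UG_eps (C L : R) :
  (forall g : X -> \bar R, borel_nonneg g -> g x < +oo -> g y < +oo ->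
    lim (least_integral C g e @[e --> (0 : R)^'+]) <=
    (C * D)%:E * \int[riesz_measure m L x y]_z (g z `^ p)) ->
  forall (u : X -> R) (e : R), (0 < e)%R ->
  forall g : X -> \bar R, UG_eps e u g -> g x < +oo -> g y < +oo ->
    (`|u x - u y| `^ p)%:E <=
    (C * D)%:E * \int[riesz_measure m L x y]_z (g z `^ p).
Proof.
move=> H u e e0 g [gb ug] gx gy; apply: le_trans (H g gb gx gy).
apply: (least_integral_lim_ge e0) => e' e'0 e'e.
apply: le_ereal_inf_tmp => _ [c [[cp cl] _] <-].
apply: le_real_pow => //; rewrite distrC -cl; apply: ug.
by apply: sub_path cp => a b /le_trans; apply.
Qed.

(** The slope of u at scale 1 / (n + 1) bounds the increments of u over steps of length
    at most 1 / (n + 2). *)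
Lemma UG_eps_slope_poincare (C L : R) :
  (forall u : X -> R, borel_real u -> forall e : R, (0 < e)%R ->
  forall g : X -> \bar R, UG_eps e u g -> g x < +oo -> g y < +oo ->
    (`|u x - u y| `^ p)%:E <=
    C%:E * \int[riesz_measure m L x y]_z (g z `^ p)) ->
  slope_poincare C L.
Proof.
move=> H u uL n; have n0 : (0 < n.+2%:R^-1 :> R)%R by [].
have sfin z := slope_lty n.+1%:R^-1 z uL.
exact: (H u (Lipschitz_borel_real uL) _ n0 _ (slope_UG_eps n uL) (sfin x) (sfin y)).
Qed.

(** Twice the slope of u is an upper gradient along curves: this spares the
    differentiation of u along curves. *)
Lemma UG_slope_poincare (C L : R) : (1 <= L)%R ->
  (forall u : X -> R, borel_real u -> forall g : X -> \bar R, UG u g ->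
    (`|u x - u y| `^ p)%:E <=
    C%:E * \int[riesz_measure m L x y]_z (g z `^ p)) ->
  slope_poincare (C * 2 `^ p) L.
Proof.
move=> L1 H u uL n; have [nu nufin nuE] := riesz_measure_finite_measure hm hD x y L1.
have n0 : (0 < n.+2%:R^-1 :> R)%R by [].
have su := slope_UG_eps n uL.
have := H u (Lipschitz_borel_real uL) _
  (UG_of_UG_eps n0 (fun z => slope_lty n.+1%:R^-1 z uL) su).
have -> : \int[riesz_measure m L x y]_z ((2%:E * slope n.+1%:R^-1 u z) `^ p) =
    (2 `^ p)%:E * \int[riesz_measure m L x y]_z (slope n.+1%:R^-1 u z `^ p).
  rewrite -nuE -ge0_integralZl//.
  - by apply: eq_integral => z _; rewrite poweRM ?slope_ge0// poweR_EFin.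
  - exact: (measurable_fun_cara_pow hm _ su.1.2).
  - by move=> z _; exact: poweR_ge0.
by rewrite muleA -EFinM.
Qed.

End equivalence.

Theorem mainTheorem6 (R : realType) (p : R) (hp : (1 <= p)%R)
    (X : completeMetricType R) (m : {outer_measure set X -> \bar R})
    (hm : metric_measure_space m) (hD : doubling m) (x y : X) :
  [<->
    exists C L : R, [/\ (0 < C)%R, (1 <= L)%R &
      forall u : X -> R, Lipschitz u ->
        (`|u x - u y| `^ p)%:E <=
        (C * mdist x y `^ (p - 1))%:E *
          \int[riesz_measure m L x y]_z (lip u z `^ p)];
    exists C L : R, [/\ (0 < C)%R, (1 <= L)%R &
      forall g : X -> \bar R, borel_nonneg g -> g x < +oo -> g y < +oo ->
        lim (ereal_inf [set chain_integral g x c `^ p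
                       | c in [set c | chains e x y c /\
                                 (chain_length x c <= C * mdist x y)%R]]
             @[e --> (0 : R)^'+]) <=
        (C * mdist x y `^ (p - 1))%:E *
          \int[riesz_measure m L x y]_z (g z `^ p)];
    exists C L : R, [/\ (0 < C)%R, (1 <= L)%R &
      forall u : X -> R, borel_real u ->
      forall e : R, (0 < e)%R ->
      forall g : X -> \bar R, UG_eps e u g -> g x < +oo -> g y < +oo ->
        (`|u x - u y| `^ p)%:E <=
        (C * mdist x y `^ (p - 1))%:E *
          \int[riesz_measure m L x y]_z (g z `^ p)];
    exists C L : R, [/\ (0 < C)%R, (1 <= L)%R &
      forall u : X -> R, borel_real u ->
      forall g : X -> \bar R, UG u g ->
        (`|u x - u y| `^ p)%:E <=
        (C * mdist x y `^ (p - 1))%:E *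
          \int[riesz_measure m L x y]_z (g z `^ p)]].
Proof.
(* If x = y, all the left-hand sides vanish; for the second property, so does the
   integral over the chain reduced to x. *)
have [<-|xy] := eqVneq x y.
  have diag (u : X -> R) C L (g : X -> \bar R) : (0 <= C)%R -> (1 <= L)%R ->
      (`|u x - u x| `^ p)%:E <= C%:E * \int[riesz_measure m L x x]_z (g z `^ p).
    move=> C0 L1; rewrite subrr normr0 powR0 ?gt_eqF ?(lt_le_trans ltr01)//.
    by rewrite mule_ge0// riesz_integral_pow_ge0.
  have C0 : (0 <= 1 * mdist x x `^ (p - 1))%R by rewrite mul1r powR_ge0.
  tfae=> _; exists 1%R, 1%R; split => //; try by move=> *; exact: diag.
  move=> g gb gx _; apply: (@le_trans _ _ 0); last first.
    by rewrite mule_ge0// riesz_integral_pow_ge0.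
  apply: (@least_integral_lim_le _ _ p x x 1%R) => e e0; apply: ge_ereal_inf.
  exists (chain_integral g x [::] `^ p).
    by exists [::] => //; split => //; rewrite /chain_length/= big_nil mul1r mdist_ge0.
  by rewrite /chain_integral/= big_nil poweR0r// gt_eqF// (lt_le_trans ltr01).
set D := (mdist x y `^ (p - 1))%R.
have D0 : (0 < D)%R by rewrite powR_gt0// mdist_gt0.
tfae.
- move=> [C [L [C0 L1 H]]].
  have CD : (0 < C * D)%R by rewrite mulr_gt0.
  have [C' C'0 H'] := short_curves_chains hm hD hp xy L1
    (lip_poincare_short_curves hm hD hp CD L1 H).
  by exists C', L; split.
- move=> [C [L [C0 L1 H]]]; exists C, L; split => // u _.
  exact: (chains_UG_eps hp H).
- move=> [C [L [C0 L1 H]]].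
  have CD : (0 < C * D)%R by rewrite mulr_gt0.
  have [C' C'0 H'] := short_curves_UG hm hD hp xy L1
    (lip_poincare_short_curves hm hD hp CD L1
      (slope_poincare_lip hm hD hp L1 (UG_eps_slope_poincare H))).
  by exists C', L; split => // u _ g; exact: H'.
- move=> [C [L [C0 L1 H]]].
  have := slope_poincare_lip hm hD hp L1 (UG_slope_poincare hm hD L1 H).
  rewrite -/D mulrAC => H'; exists (C * 2 `^ p)%R, L; split => //.
  by rewrite mulr_gt0// powR_gt0.
Qed.
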